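(* Let $P,Q\subseteq\mathbb{R}^d$ be rational polytopes with $P\subseteq Q$, and let $g$ be a common multiple of the denominators $\delta(P)$ and $\delta(Q)$. Then for every weight $w\in R_Q$ that is homogeneous of degree $m$, \[(1+t^{\delta(P)}+\cdots+t^{g-\delta(P)})^{\dim P+m+1}h^*_{P,w}(t)\preceq(1+t^{\delta(Q)}+\cdots+t^{g-\delta(Q)})^{\dim Q+m+1}h^*_{Q,w}(t).\] In particular, if $\delta(P)=\delta(Q)$, then $h^*_{P,w}(t)\preceq h^*_{Q,w}(t)$.
   Context: For a rational polytope $P\subseteq\mathbb{R}^d$, $\mathrm{C}(P)=\{c(p,1)\mid c\ge0,\ p\in P\}\subseteq\mathbb{R}^{d+1}$ and $\delta(P)$ is the smallest positive integer $q$ such that $qP$ has vertices in $\mathbb{Z}^d$ (the empty polytope has denominator $1$). For a polynomial $w$ on $\mathbb{R}^{d+1}$, $\mathrm{Ehr}(P,w;t)=\sum_{x\in\mathrm{C}(P)\cap\mathbb{Z}^{d+1}}w(x)t^{x_{d+1}}$; for $w$ homogeneous of degree $m$, $h^*_{P,w}(t)$ is the polynomial with $\mathrm{Ehr}(P,w;t)=h^*_{P,w}(t)/(1-t^{\delta(P)})^{\dim P+m+1}$ (it is $0$ if $P$ is empty). $R_Q$ is the semiring of polynomials on $\mathbb{R}^{d+1}$ of the form $c_1p_1+\cdots+c_kp_k$ with $c_i>0$ and each $p_i$ a product of linear forms on $\mathbb{R}^{d+1}$ each nonnegative on $\mathrm{C}(Q)$. $f\preceq g$ means coefficientwise inequality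 of polynomials. *)

(* Defs.v *)
From mathcomp Require Import all_boot all_order all_algebra.
From mathcomp Require Import boolp classical_sets fsbigop reals.
From mathcomp Require Import mpoly.

Set Implicit Arguments.
Unset Strict Implicit.
Unset Printing Implicit Defensive.

Import Order.TTheory GRing.Theory Num.Theory.

Local Open Scope classical_set_scope.
Local Open Scope ring_scope.

(* Junk value 0 when A is empty. *)
Definition least (A : set nat) : nat :=
  xget 0%N [set n | A n /\ forall k, A k -> (n <= k)%N].

Section Polytopes.
Variables (R : realType) (d : nat).
Implicit Types P Q : set 'rV[R]_d.

Definition conv (s : seq 'rV[R]_d) : set 'rV[R]_d :=
  [set x | exists c : 'I_(size s) -> R,
     [/\ forall i, 0 <= c i, \sum_i c i = 1 & x = \sum_i c i *: s`_i]].

Definition rational_polytope P : Prop :=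
  exists V : seq 'rV[rat]_d, P = conv [seq map_mx ratr v | v <- V].

(* A vertex is a 0-dimensional face: v is the unique maximizer over P of the
   linear functional x |-> x *m a. *)
Definition vertex P (v : 'rV[R]_d) : Prop :=
  P v /\ exists a : 'cV[R]_d,
    forall x, P x -> x <> v -> (x *m a) 0 0 < (v *m a) 0 0.

Definition dilate (q : nat) P : set 'rV[R]_d := [set q%:R *: x | x in P].

Definition integral_point (v : 'rV[R]_d) : Prop :=
  exists z : 'rV[int]_d, v = map_mx intr z.

Definition denominator P : nat :=
  least [set q | (0 < q)%N /\
                 forall v, vertex (dilate q P) v -> integral_point v].

(* Dimension of the linear space parallel to the affine hull of P. *)
Definition direction_dim P : nat :=
  least [set n | exists U : {vspace 'rV[R]_d},
     (forall x y, P x -> P y -> x - y \in U) /\ \dim U = n].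

Definition pdim P : int := if `[< P = set0 >] then -1 else (direction_dim P)%:Z.

Definition cone P : set 'rV[R]_(d + 1) :=
  [set x | exists c p, [/\ 0 <= c, P p & x = c *: row_mx p (const_mx 1)]].

(* The coefficient of t^n in Ehr(P, w; t); cone P lies in the half-space where
   the last coordinate is nonnegative, so no negative power of t occurs. The
   index set is finite when P is bounded. *)
Definition ehr P (w : {mpoly R[d + 1]}) (n : nat) : R :=
  \sum_(x \in [set x : 'rV[int]_(d + 1) |
                 cone P (map_mx intr x) /\ x 0 (rshift d 0) = n%:Z])
     w.@[(map_mx intr x : 'rV[R]_(d + 1)) 0].

(* dim P + m + 1, which is a natural number since dim P >= -1. *)
Definition hstar_exp P (m : nat) : nat := absz (pdim P + m%:Z + 1).

(* The identity h = (1 - t^delta(P))^(dim P + m + 1) * Ehr(P, w; t) between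
   formal power series, coefficient by coefficient. *)
Definition is_hstar P (w : {mpoly R[d + 1]}) (m : nat) (h : {poly R}) : Prop :=
  forall n, h`_n = \sum_(i < n.+1)
    ((1 - 'X^(denominator P)) ^+ hstar_exp P m)`_i * ehr P w (n - i).

(* At most one h satisfies is_hstar, so this is a definite description (with
   junk value 0 when there is no such polynomial). *)
Definition hstar P (w : {mpoly R[d + 1]}) (m : nat) : {poly R} :=
  xget 0 [set h | is_hstar P w m h].

Definition nonneg_linear_form Q (l : {mpoly R[d + 1]}) : Prop :=
  l \is 1.-homog /\ forall x, cone Q x -> 0 <= l.@[x 0].

Definition weight_semiring Q : set {mpoly R[d + 1]} :=
  [set w | exists s : seq (R * seq {mpoly R[d + 1]}),
     (forall cp, cp \in s ->
        0 < cp.1 /\ forall l, l \in cp.2 -> nonneg_linear_form Q l) /\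
     w = \sum_(cp <- s) cp.1 *: \prod_(l <- cp.2) l].

End Polytopes.

Definition coef_le (R : realType) (f g : {poly R}) : Prop :=
  forall n, f`_n <= g`_n.

(* 1 + t^q + t^(2q) + ... + t^(g - q), for q dividing g > 0. *)
Definition geom_poly (R : realType) (q g : nat) : {poly R} :=
  \sum_(i < g %/ q) 'X^(i * q).

(* Main.v *)
(** Let g be a common multiple of the denominators.  The cone over Q is spanned
    by integer vectors u_1, ..., u_n at height g, the vertices of P coming first.
    Representing a point by the nonnegative combination of the u_i that is least
    for the lexicographic order in which late coordinates weigh most triangulates
    the cone over Q, and the cone over P is a subcomplex.  Perturbing a point x
    into x + e u_1 + e^2 u_2 + ... assigns it to one maximal simplicial cone, so
    both cones become disjoint unions of half-open simplicial cones, and each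
    piece for P is a face of a piece for Q with no further facet removed.

    On one piece, a product of m linear forms is a combination with nonnegative
    coefficients of monomials of degree m in the simplicial coordinates.
    Multiplying the generating function by 1 - t^g amounts to a backward
    difference in any one of these coordinates.  With r the number of generators
    of the piece, r + m differences, one more than the exponent in each
    coordinate, turn truncated powers into cardinal B-splines, which are
    nonnegative with compact support.  The numerators are thus sums of nonnegative
    terms, and the terms of P occur among those of Q. *)

Require Import Defs.
From mathcomp Require Import all_boot all_order all_algebra.
From mathcomp Require Import boolp classical_sets functions cardinality fsbigop reals.
From mathcomp Require Import mpoly.
From mathcomp Require Import ring lra.

Set Implicit Arguments.
Unset Strict Implicit.
Unset Printing Implicit Defensive.

Import Order.TTheory GRing.Theory Num.Theory.

Local Open Scope ring_scope.

(** * Lexicographic triangulation of a cone *)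

Section LexTriangulation.
Variables (R : realFieldType) (n D : nat) (U : 'M[R]_(n, D)).
Implicit Types (k l mu nu : 'rV[R]_n) (I J F : {set 'I_n}).

Definition lexneg k : Prop :=
  exists j, k 0 j < 0 /\ forall i : 'I_n, (j < i)%N -> k 0 i = 0.

Definition supported F k : Prop := forall j, j \notin F -> k 0 j = 0.

(** The dependencies [k] nonnegative off [F] are the directions in which a point with positive
    coordinates on [F] and zeros elsewhere can move while keeping its image and staying nonnegative.
    Optimal sets are the faces of the lexicographic triangulation. *)
Definition optimal F : Prop :=
  forall k, k *m U = 0 -> (forall j, j \notin F -> 0 <= k 0 j) -> ~ lexneg k.

Lemma lexneg_total k : k != 0 -> lexneg k \/ lexneg (- k).
Proof.
move=> k0; have [j0 kj0] : exists j, k 0 j != 0.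
  apply/existsP; apply: contra_neqT k0 => /existsPn k0.
  by apply/rowP => j; rewrite mxE; apply/eqP; have := k0 j; rewrite negbK.
case: (@arg_maxnP _ j0 (fun j => k 0 j != 0) (fun j => j : nat) kj0) => j kj maxj.
have top (i : 'I_n) : (j < i)%N -> k 0 i = 0.
  by move=> ji; apply/eqP; apply: contraTT ji => /maxj; rewrite -leqNgt; apply.
case: (ltgtP (k 0 j) 0) kj => // kj _; [left|right]; exists j; split=> //.
  by rewrite mxE oppr_lt0.
by move=> i /top ki; rewrite mxE ki oppr0.
Qed.

Lemma lexneg0 : ~ lexneg 0.
Proof. by case=> j []; rewrite mxE ltxx. Qed.

Lemma lexnegZ (a : R) k : 0 < a -> lexneg k -> lexneg (a *: k).
Proof.
move=> a0 [j [kj top]]; exists j; split; first by rewrite mxE pmulr_rlt0.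
by move=> i /top ki; rewrite mxE ki mulr0.
Qed.

Lemma lexnegD k l : lexneg k -> lexneg l -> lexneg (k + l).
Proof.
move=> [i [ki topi]] [j [lj topj]].
case: (ltngtP i j) => [ij|ji|/ord_inj ij].
- exists j; split; first by rewrite mxE topi// add0r.
  by move=> h jh; rewrite mxE topj// topi ?addr0// (ltn_trans ij).
- exists i; split; first by rewrite mxE topj// addr0.
  by move=> h ih; rewrite mxE topi// topj ?addr0// (ltn_trans ji).
- subst j; exists i; split; first by rewrite mxE ltr_wnDr// ltW.
  by move=> h ih; rewrite mxE topi// topj ?addr0.
Qed.

Lemma optimal0 : optimal finset.set0.
Proof. by move=> k _ k0 [j [+ _]]; rewrite ltNge k0// inE. Qed.

(** A nonzero dependency on [F], or its opposite, would be a lexicographic descent; so the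
    generators in [F] are linearly independent. *)
Lemma optimal_free F k : optimal F -> supported F k -> k *m U = 0 -> k = 0.
Proof.
move=> optF sk kU; apply/eqP; apply/negP => /negP /lexneg_total[].
  by apply: optF => // j /sk ->.
by apply: optF; rewrite ?mulNmx ?kU ?oppr0// => j /sk; rewrite mxE => ->; rewrite oppr0.
Qed.

Lemma optimal_inj F k l :
  optimal F -> supported F k -> supported F l -> k *m U = l *m U -> k = l.
Proof.
move=> optF sk sl kl; apply/eqP; rewrite -subr_eq0; apply/eqP.
apply: (optimal_free optF); last by rewrite mulmxBl kl subrr.
by move=> j jF; rewrite !mxE sk// sl// subrr.
Qed.

Section Step.
Variables (I : {set 'I_n}) (nu : 'rV[R]_n).
Hypothesis optI : optimal I.
Hypothesis nu_ge0 : forall j, j \notin I -> 0 <= nu 0 j.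

Let feasible mu := mu *m U = nu *m U /\ forall j, j \notin I -> 0 <= mu 0 j.
Let carrier mu := I :|: [set j | mu 0 j != 0]%SET.
Let free_on J := forall k, supported J k -> k *m U = 0 -> k = 0.
Let basic mu := feasible mu /\ free_on (carrier mu).

(** The ratio test of the simplex method. Optimality of [I] forces [k] to decrease some coordinate
    outside [I], and the step ends when the first of these reaches zero. *)
Let pivot mu k : feasible mu -> k *m U = 0 -> lexneg k ->
    (forall j, j \notin carrier mu -> 0 <= k 0 j) ->
  exists t, [/\ 0 < t, feasible (mu + t *: k) &
    exists j, [/\ j \notin I, j \in carrier mu & (mu + t *: k) 0 j = 0]].
Proof.
move=> [muU mu0] kU kneg kc.
have [j0 /andP[j0I kj0]] : exists j, (j \notin I) && (k 0 j < 0).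
  apply/existsP; apply: contraT => /existsPn h; case: (optI kU _ kneg) => j jI.
  by have := h j; rewrite jI /= -leNgt.
have := @Order.TotalTheory.arg_minP _ _ _ j0
  (fun j => (j \notin I) && (k 0 j < 0)) (fun j => mu 0 j / - k 0 j).
case; first by rewrite j0I.
move=> j /andP[jI kj] minj; have jc : j \in carrier mu.
  by apply: contraTT kj => /kc; rewrite -leNgt.
have muj : 0 < mu 0 j.
  by rewrite lt_neqAle eq_sym mu0// andbT; move: jc; rewrite !inE (negPf jI).
exists (mu 0 j / - k 0 j); split.
- by rewrite divr_gt0// oppr_gt0.
- split; first by rewrite mulmxDl -scalemxAl kU scaler0 addr0.
  move=> i iI; rewrite !mxE; case: (ltP (k 0 i) 0) => ki; last first.
    by rewrite addr_ge0 ?mu0// mulr_ge0// divr_ge0 ?ltW// oppr_gt0.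
  have := minj i; rewrite iI ki => /(_ isT).
  by rewrite ler_pdivlMr ?oppr_gt0// mulrN -subr_ge0 opprK.
exists j; split=> //; rewrite !mxE invrN mulrN mulNr mulfVK ?subrr//.
by rewrite lt_eqF.
Qed.

(** While the carrier is dependent, a dependency on it, signed so as to descend, gives a pivot that
    strictly shrinks the carrier. *)
Let reduce mu : feasible mu ->
  exists2 mu', basic mu' & mu' = mu \/ lexneg (mu' - mu).
Proof.
have [m] := ubnP #|carrier mu|; elim: m mu => // m IHm mu ltm fmu.
case: (pselect (free_on (carrier mu))) => [fr|]; first by exists mu; [|left].
move=> /existsNP[k /not_implyP[sk /not_implyP[kU /eqP k0]]].
wlog kneg : k sk kU k0 / lexneg k.
  move=> wl; case: (lexneg_total k0) => kneg; first exact: (wl k).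
  apply: (wl (- k)) => //; rewrite ?oppr_eq0 ?mulNmx ?kU ?oppr0//.
  by move=> j /sk; rewrite mxE => ->; rewrite oppr0.
have [|t [t0 fmut [j [jI jc mutj]]]] := pivot fmu kU kneg.
  by move=> j /sk ->.
have [|mu' bmu' mu'mu] := IHm (mu + t *: k) _ fmut.
  rewrite ltnS in ltm; apply: leq_trans ltm; apply: proper_card.
  apply/properP; split; last by exists j => //; rewrite !inE (negPf jI) mutj eqxx.
  apply/fintype.subsetP => i; rewrite !inE => /orP[->//|]; apply: contraNT.
  rewrite negb_or negbK => /andP[iI /eqP mui]; rewrite !mxE mui sk ?mulr0 ?addr0//.
  by rewrite !inE (negPf iI) mui eqxx.
exists mu' => //; right; case: mu'mu => [->|h].
  by rewrite addrAC subrr add0r; apply: lexnegZ.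
have -> : mu' - mu = (mu' - (mu + t *: k)) + t *: k.
  by rewrite opprD addrA subrK.
by apply: lexnegD => //; apply: lexnegZ.
Qed.

(** The simplex method terminates: a basic point is determined by its carrier, so there are finitely
    many, and each non-optimal one is followed by a lexicographically smaller one. *)
Lemma optimal_step : exists mu, [/\ mu *m U = nu *m U,
  forall j, j \notin I -> 0 <= mu 0 j & optimal (I :|: [set j | mu 0 j != 0]%SET)].
Proof.
have basic_inj mu mu' : basic mu -> basic mu' -> carrier mu = carrier mu' -> mu = mu'.
  move=> [[muU _] fr] [[mu'U _] _] cc; apply/eqP; rewrite -subr_eq0; apply/eqP.
  apply: fr; last by rewrite mulmxBl muU mu'U subrr.
  move=> j jc; have := jc; rewrite cc !inE !negb_or !negbK !mxE => /andP[_ /eqP->].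
  by move: jc; rewrite !inE negb_or negbK => /andP[_ /eqP->]; rewrite subrr.
have [mu0 bmu0 _] : exists2 mu', basic mu' & mu' = nu \/ lexneg (mu' - nu).
  by apply: reduce; split.
(* The termination measure counts the carriers of the basic points strictly below [mu]. *)
pose below mu := [set J | `[< exists mu', [/\ basic mu', carrier mu' = J &
  lexneg (mu' - mu)] >]]%SET.
have [m] := ubnP #|below mu0|; elim: m mu0 bmu0 => // m IHm mu bmu ltm.
case: (pselect (optimal (carrier mu))) => [opt|].
  by case: bmu => -[muU mu_ge0] _; exists mu.
move=> /existsNP[k /not_implyP[kU /not_implyP[kc /contrapT kneg]]].
have [t [t0 fmut _]] := pivot bmu.1 kU kneg kc.
have [mu' bmu' mu'mu] := reduce fmut.
have lt_mu' : lexneg (mu' - mu).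
  case: mu'mu => [->|h]; first by rewrite addrAC subrr add0r; apply: lexnegZ.
  have -> : mu' - mu = (mu' - (mu + t *: k)) + t *: k.
    by rewrite opprD addrA subrK.
  by apply: lexnegD => //; apply: lexnegZ.
apply: (IHm mu' bmu'); rewrite ltnS in ltm; apply: leq_trans ltm.
apply: proper_card; apply/properP; split.
  apply/fintype.subsetP => J; rewrite !finset.in_set => /asboolP[nu' [bn cn ln]].
  apply/asboolP; exists nu'; split=> //.
  by rewrite -(subrK mu' nu') -addrA; apply: lexnegD.
exists (carrier mu'); first by rewrite finset.in_set; apply/asboolP; exists mu'.
rewrite finset.in_set; apply/asboolPn => -[nu' [bn /(basic_inj _ _ bn bmu') ->]].
by rewrite subrr; apply: lexneg0.
Qed.

End Step.
End LexTriangulation.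

(** * Half-open decomposition of the cone by perturbation *)

Section Chambers.
Variables (R : realFieldType) (n D : nat) (U : 'M[R]_(n, D)).
Implicit Types (k : nat) (l r mu nu : 'rV[R]_n) (I J F : {set 'I_n}).
Implicit Types (rows nus : seq 'rV[R]_n).

(** Positivity of the polynomial a0 + a1 e + a2 e^2 + ... for all small e > 0, read off its
    coefficients. *)
Fixpoint lexpos (s : seq R) : bool :=
  if s is a :: s' then (0 < a) || ((a == 0) && lexpos s') else false.

Definition column (j : 'I_n) rows : seq R := [seq r 0 j | r : 'rV[R]_n <- rows].

(** Each use of [optimal_step] frees the coordinates already used. A coordinate that enters [F]
    becomes nonzero in a row where it is still constrained to be nonnegative, so the first nonzero
    entry of its column is positive. *)
Lemma lift_rows I nus :
    optimal U I -> (forall nu, nu \in nus -> forall j, 0 <= nu 0 j) ->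
  exists F rows, [/\ optimal U F, I \subset F,
    [seq r *m U | r <- rows] = [seq nu *m U | nu <- nus],
    forall r, r \in rows -> supported F r &
    forall j, j \in F -> j \notin I -> lexpos (column j rows)].
Proof.
elim: nus I => [|nu nus IHs] I optI nus0.
  by exists I, [::]; split=> // j ->.
have nu0 j : j \notin I -> 0 <= nu 0 j by move=> _; apply: nus0; rewrite inE eqxx.
have [mu [muU mu0 optI']] := optimal_step optI nu0.
have [|F [rows [optF sF eqU sup pos]]] := IHs _ optI'.
  by move=> nu' nu'in; apply: nus0; rewrite inE nu'in orbT.
move: sF; rewrite finset.subUset => /andP[sIF sF].
exists F, (mu :: rows); split=> //=.
- by rewrite muU eqU.
- move=> r; rewrite inE => /predU1P[->|/sup//] j jF.
  apply: contraNeq jF => muj; apply: (fintype.subsetP sF).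
  by rewrite finset.in_set.
move=> j jF jI; case: (eqVneq (mu 0 j) 0) => muj /=.
  by rewrite muj /= pos ?orbT// finset.in_setU finset.in_set muj eqxx (negPf jI).
by rewrite lt_neqAle eq_sym muj mu0.
Qed.

Definition lexnn (s : seq R) : bool := lexpos s || all (pred1 0) s.

Lemma lexnn_cons a s : lexnn (a :: s) -> (0 <= a) && ((a == 0) ==> lexnn s).
Proof.
rewrite /lexnn /=; case: (ltgtP a 0) => //=.
Qed.

(* At the first row where the two lifts differ, their difference is a
   dependency that is nonnegative off both optimal sets up to sign. *)
Lemma rows_unique F1 F2 rows1 rows2 :
    optimal U F1 -> optimal U F2 ->
    [seq r *m U | r <- rows1] = [seq r *m U | r <- rows2] ->
    (forall r, r \in rows1 -> supported F1 r) ->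
    (forall r, r \in rows2 -> supported F2 r) ->
    (forall j, j \notin F1 -> lexnn (column j rows2)) ->
    (forall j, j \notin F2 -> lexnn (column j rows1)) ->
  rows1 = rows2.
Proof.
move=> opt1 opt2; elim: rows1 rows2 => [|r1 s1 IHs] [|r2 s2] //= [eqU eqs].
move=> sup1 sup2 nn2 nn1.
have sr1 : supported F1 r1 by apply: sup1; rewrite inE eqxx.
have sr2 : supported F2 r2 by apply: sup2; rewrite inE eqxx.
have r12 : r1 = r2.
  apply/eqP; rewrite -subr_eq0; apply/negP => /negP /lexneg_total[].
    apply: opt2; first by rewrite mulmxBl eqU subrr.
    by move=> j jF; rewrite !mxE (sr2 _ jF) subr0; case/andP: (lexnn_cons (nn1 _ jF)).
  rewrite opprB; apply: opt1; first by rewrite mulmxBl eqU subrr.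
  by move=> j jF; rewrite !mxE (sr1 _ jF) subr0; case/andP: (lexnn_cons (nn2 _ jF)).
rewrite -r12 in sr2 nn2 *; congr (_ :: _); apply: IHs => //.
- by move=> r rs; apply: sup1; rewrite inE rs orbT.
- by move=> r rs; apply: sup2; rewrite inE rs orbT.
- by move=> j jF; case/andP: (lexnn_cons (nn2 _ jF)); rewrite (sr1 _ jF) eqxx.
- by move=> j jF; case/andP: (lexnn_cons (nn1 _ jF)); rewrite (sr2 _ jF) eqxx.
Qed.

Definition units : seq 'rV[R]_n := [seq delta_mx 0 i | i <- enum 'I_n].

(** The rows express the generators u_1, ..., u_n through those in [F]; so a [chamber] is an optimal
    set indexing a basis of the row space of [U]. *)
Definition frame F rows : Prop :=
  [/\ optimal U F, [seq r *m U | r <- rows] = [seq e *m U | e <- units] &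
      forall r, r \in rows -> supported F r].

Definition chamber F : Prop := exists rows, frame F rows.

(* The coordinates of the perturbed point x + e u_1 + e^2 u_2 + ... are
   polynomials in e; [removed F] lists the facets of the simplicial cone over F
   from which the perturbation points outwards. *)
Definition removed F : {set 'I_n} :=
  [set j | `[< exists rows, frame F rows /\ ~~ lexpos (column j rows) >]]%SET.

Definition halfopen F (A : {set 'I_n}) l : Prop :=
  supported F l /\
  forall j, j \in F -> if j \in A then 0 < l 0 j else 0 <= l 0 j.

Lemma frame_inj F rows1 rows2 : frame F rows1 -> frame F rows2 -> rows1 = rows2.
Proof.
move=> [optF eq1 sup1] [_ eq2 sup2]; apply: (rows_unique optF optF) => //.
- by rewrite eq1 eq2.
- move=> j jF; rewrite /lexnn; apply/orP; right; apply/allP => a /mapP[r rin ->] /=.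
  by rewrite (sup2 _ rin).
- move=> j jF; rewrite /lexnn; apply/orP; right; apply/allP => a /mapP[r rin ->] /=.
  by rewrite (sup1 _ rin).
Qed.

Lemma removedE F rows j : frame F rows -> (j \in removed F) = ~~ lexpos (column j rows).
Proof.
move=> fr; rewrite finset.in_set; apply/asboolP/idP => [[rows' [fr' npos]]|npos].
  by rewrite (frame_inj fr fr').
by exists rows.
Qed.

(** The columns of [l :: rows] are the coordinates of the perturbed point. A zero coordinate of [l]
    is allowed exactly when the perturbation makes it positive. *)
Lemma halfopen_lexpos F rows l : frame F rows ->
  halfopen F (removed F) l <->
  (supported F l /\ forall j, j \in F -> lexpos (column j (l :: rows))).
Proof.
move=> fr; split=> -[sl pos]; split=> // j jF; have := pos j jF;
  rewrite (removedE _ fr) /=; case: (lexpos _) => //=; rewrite ?andbT ?andbF ?orbF //.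
  by rewrite le_eqVlt eq_sym orbC.
by rewrite le_eqVlt eq_sym orbC.
Qed.

(** Lifting [l0] followed by all the units, from the empty set on, yields both the coordinates of
    the point and a frame. *)
Lemma chamber_cover l0 : (forall j, 0 <= l0 0 j) ->
  exists F l, [/\ chamber F, halfopen F (removed F) l & l *m U = l0 *m U].
Proof.
move=> l00; have [|F [[|l rows] [optF _ //= [eql eqU] sup pos]]] :=
    @lift_rows finset.set0 (l0 :: units) (@optimal0 _ _ _ U).
  move=> nu; rewrite inE => /predU1P[->//|/mapP[i _ ->]] j.
  by rewrite mxE eqxx /=; case: eqP.
have fr : frame F rows.
  by split=> // r rin; apply: sup; rewrite inE rin orbT.
exists F, l; split=> //; first by exists rows.
apply/(halfopen_lexpos _ fr); split; first by apply: sup; rewrite inE eqxx.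
by move=> j jF; apply: pos; rewrite ?finset.in_set0.
Qed.

Lemma halfopen_lexnn F rows l : frame F rows -> halfopen F (removed F) l ->
  forall j, lexnn (column j (l :: rows)).
Proof.
move=> fr /(halfopen_lexpos _ fr)[sl pos] j; rewrite /lexnn.
case: (boolP (j \in F)) => jF; first by rewrite pos.
apply/orP; right; rewrite /= sl// eqxx /=; case: fr => _ _ sup.
by apply/allP => a /mapP[r rin ->] /=; rewrite sup.
Qed.

(** The two lifts of the perturbed point agree by [rows_unique], and the chamber is recovered as the
    set of nonzero columns. *)
Lemma chamber_disjoint F1 F2 l1 l2 : chamber F1 -> chamber F2 ->
    halfopen F1 (removed F1) l1 -> halfopen F2 (removed F2) l2 ->
    l1 *m U = l2 *m U -> F1 = F2 /\ l1 = l2.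
Proof.
move=> [rows1 fr1] [rows2 fr2] h1 h2 eql.
have [opt1 eq1 sup1] := fr1; have [opt2 eq2 sup2] := fr2.
have eqr : l1 :: rows1 = l2 :: rows2.
  apply: (rows_unique opt1 opt2); first by rewrite /= eql eq1 eq2.
  - by move=> r; rewrite inE => /predU1P[->|/sup1//]; case: h1.
  - by move=> r; rewrite inE => /predU1P[->|/sup2//]; case: h2.
  - by move=> j _; apply: (halfopen_lexnn fr2 h2).
  - by move=> j _; apply: (halfopen_lexnn fr1 h1).
have /(halfopen_lexpos _ fr1)[sl1 pos1] := h1.
have /(halfopen_lexpos _ fr2)[sl2 pos2] := h2.
have lex0 s : lexpos s -> ~~ all (pred1 0) s.
  elim: s => //= a s IHs /orP[/gt_eqF->//|/andP[_ /IHs]].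
  by rewrite negb_and orbC => ->.
have notall F l rows j : frame F rows -> supported F l -> j \notin F ->
    all (pred1 0) (column j (l :: rows)).
  move=> [_ _ sup] sl jF; rewrite /= sl// eqxx /=.
  by apply/allP => a /mapP[r rin ->] /=; rewrite sup.
split; last by case: eqr.
apply/finset.setP => j; apply/idP/idP => jF; apply: contraT => jF'.
  by have := lex0 _ (pos1 _ jF); rewrite eqr (notall _ _ _ _ fr2 sl2 jF').
by have := lex0 _ (pos2 _ jF); rewrite -eqr (notall _ _ _ _ fr1 sl1 jF').
Qed.

Definition below (k : nat) : {set 'I_n} := [set i : 'I_n | (i < k)%N]%SET.

(** This makes the cone over the first [k] generators a subcomplex. As [nu - r] is a dependency
    nonnegative off [F], the lexicographically negative one is [r - nu]; a nonzero coordinate of [r]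
    beyond [k] would make its last nonzero entry a negative coordinate of [r] beyond [k]. *)
Lemma supported_below F k r nu : optimal U F -> r *m U = nu *m U ->
    supported F r -> supported (below k) nu -> (forall j, 0 <= nu 0 j) ->
    (forall j, j \in F -> j \notin below k -> 0 <= r 0 j) ->
  supported (below k) r.
Proof.
move=> optF eqU sr snu nu0 r0 j jk; apply/eqP/negP => /negP rj.
have dj : nu - r != 0.
  apply: contra_neq rj => /rowP/(_ j); rewrite !mxE snu// => /eqP.
  by rewrite sub0r oppr_eq0 => /eqP.
have dU : (nu - r) *m U = 0 by rewrite mulmxBl eqU subrr.
case: (lexneg_total dj); first by apply: optF => // i iF; rewrite !mxE (sr _ iF) subr0.
case=> h [dh top]; have hk : h \notin below k.
  apply/negP; rewrite finset.in_set => hk.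
  have := top j; rewrite !mxE snu// sub0r opprK => /(_ _)/eqP.
  rewrite (negPf rj) => /(_ _)/notF; apply.
  by move: jk; rewrite finset.in_set -leqNgt; apply: leq_trans.
move: dh; rewrite !mxE (snu _ hk) sub0r opprK ltNge.
case: (boolP (h \in F)) => hF; first by rewrite r0.
by rewrite (sr _ hF) lexx.
Qed.

(** At a coordinate beyond [k] the earlier rows vanish, so positivity of the column makes the next
    row nonnegative there. The positive entry itself then sits in [rest]. *)
Lemma rows_below F k rows rest nus : optimal U F ->
    [seq r *m U | r <- rows] = [seq nu *m U | nu <- nus] ->
    (forall r, r \in rows -> supported F r) ->
    (forall nu, nu \in nus -> supported (below k) nu /\ forall j, 0 <= nu 0 j) ->
    (forall j, j \in F -> j \notin below k -> lexpos (column j (rows ++ rest))) ->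
  forall r, r \in rows -> supported (below k) r.
Proof.
move=> optF; elim: rows nus => [|r rows IHr] [|nu nus] //= [eqr eqs] sup hnu pos.
have sr : supported (below k) r.
  have [snu nu0] := hnu nu (mem_head _ _).
  apply: (supported_below optF eqr) => //; first by apply: sup; rewrite inE eqxx.
  by move=> j jF jk; have := pos j jF jk; case: (ltgtP (r 0 j) 0) => // ->.
move=> r'; rewrite inE => /predU1P[->//|]; apply: (IHr nus eqs) => //.
- by move=> r'' r''in; apply: sup; rewrite inE r''in orbT.
- by move=> nu' nu'in; apply: hnu; rewrite inE nu'in orbT.
- by move=> j jF jk; have := pos j jF jk; rewrite sr// ltxx eqxx.
Qed.

Definition rk J : nat := \dim <<[seq row i U | i in J]>>%VS.

Lemma rk_free F J : optimal U F -> J \subset F -> rk J = #|J|.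
Proof.
move=> optF sJF; suff /eqP : free [seq row i U | i in J] by rewrite size_image.
apply/(@freeP _ _ _ (in_tuple _)) => c c0.
have e : #|J| = size [seq row i U | i in J] by rewrite size_image.
suff c0' (i : 'I_#|J|) : c (cast_ord e i) = 0.
  by move=> i; rewrite -(cast_ordKV e i) c0'.
pose kap : 'rV[R]_n := \sum_(i < #|J|) c (cast_ord e i) *: delta_mx 0 (enum_val i).
have kapE (h : 'I_#|J|) : kap 0 (enum_val h) = c (cast_ord e h).
  rewrite /kap summxE (bigD1 h)//= !mxE !eqxx mulr1 big1 ?addr0// => h' hh'.
  by rewrite !mxE eqxx /= (inj_eq enum_val_inj) eq_sym (negPf hh') mulr0.
rewrite -kapE; suff -> : kap = 0 by rewrite mxE.
apply: (optimal_free optF).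
  move=> j jF; rewrite /kap summxE big1// => h _; rewrite !mxE eqxx /=.
  case: eqP => [jh|]; last by rewrite mulr0.
  by move: jF; rewrite jh (fintype.subsetP sJF)// enum_valP.
rewrite /kap mulmx_suml -[RHS]c0 (reindex (cast_ord e)) /=; last first.
  by exists (cast_ord (esym e)) => x _; rewrite ?cast_ordK ?cast_ordKV.
apply: eq_bigr => h _; rewrite -scalemxAl -rowE; congr (_ *: _).
by rewrite /= (nth_image 0) //.
Qed.

(** A piece meeting the smaller cone does so in its face on [F :&: below k], which has full
    dimension there. No facet given by a coordinate beyond [k] is removed, because [l] lies on
    it. *)
Lemma chamber_face F k l l0 : chamber F -> halfopen F (removed F) l ->
    l *m U = l0 *m U -> (forall j, 0 <= l0 0 j) -> supported (below k) l0 ->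
  [/\ supported (below k) l, F :&: removed F \subset below k &
      #|F :&: below k| = rk (below k)].
Proof.
move=> [rows fr] h eql l00 sl0; have [optF eqU sup] := fr.
have /(halfopen_lexpos _ fr)[sl pos] := h.
(* Only the first [k] units accompany [l0]: like it, they are supported on the first [k]
   generators. *)
have eqT : [seq r *m U | r <- l :: take k rows] =
    [seq nu *m U | nu <- l0 :: take k units].
  by rewrite /= eql !map_take eqU.
have intake (i : 'I_n) : (i \in take k (enum 'I_n)) = (i < k)%N.
  by rewrite in_take ?mem_enum// index_enum_ord.
have supk r : r \in l :: take k rows -> supported (below k) r.
  apply: (@rows_below F k _ (drop k rows) _ optF eqT) => {r}.
  - move=> r; rewrite inE => /predU1P[->//|/mem_take]; exact: sup.
  - move=> nu; rewrite inE => /predU1P[->//|]; rewrite -map_take => /mapP[i ik ->].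
    split=> j; rewrite mxE eqxx /=; last by case: eqP.
    by rewrite finset.in_set -leqNgt; case: eqP => // -> ; rewrite leqNgt -intake ik.
  - by move=> j jF _; rewrite /= cat_take_drop; apply: pos.
have slk : supported (below k) l by apply: supk; rewrite inE eqxx.
split=> //.
  apply/fintype.subsetP => j; rewrite finset.in_setI (removedE _ fr) => /andP[jF].
  apply: contraNT => jk; have := pos j jF; rewrite /= slk// ltxx eqxx //.
rewrite -(rk_free optF (subsetIl _ _)) /rk; congr (\dim _).
apply/eqP; rewrite eqEsubv; apply/andP; split; apply/span_subvP => v.
  case/fintype.imageP => i; rewrite finset.in_setI => /andP[_ ik] ->.
  by apply: memv_span; apply: (fintype.image_f (fun i => row i U)).
case/fintype.imageP => i; rewrite finset.in_set => ik ->.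
have : row i U \in [seq e *m U | e <- take k units].
  by rewrite -map_take -map_comp; apply/mapP; exists i; rewrite ?intake//= rowE.
case: eqT => _ <- /mapP[r rin ->]; rewrite mulmx_sum_row; apply: memv_suml => j _.
case: (boolP (j \in F :&: below k)) => jFk.
  by apply: memvZ; apply: memv_span; apply: (fintype.image_f (fun i => row i U)).
suff -> : r 0 j = 0 by rewrite scale0r mem0v.
move: jFk; rewrite finset.in_setI negb_and => /orP[jF|jk].
  by rewrite (sup r)// (mem_take rin).
by rewrite (supk r)// inE rin orbT.
Qed.

End Chambers.

(** * Backward differences of truncated powers *)

Section BSplines.
Variable R : realFieldType.
Implicit Types (f : R -> R) (c : bool) (t : R).

Definition bdiff f t : R := f t - f (t - 1).

(** The flag [c] excludes the origin, which matters only for [a = 0]. *)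
Definition tpow c (a : nat) t : R := if (if c then 0 < t else 0 <= t) then t ^+ a else 0.

(** The cardinal B-spline of degree [a] multiplied by a!, supported in [0, a + 1]. *)
Definition bspline c (a : nat) : R -> R := iter a.+1 bdiff (tpow c a).

(** The Leibniz rule for iterated backward differences, with one factor linear. *)
Lemma iter_bdiff_mulX f (k : nat) t :
  iter k.+1 bdiff (fun t => t * f t) t =
  t * iter k.+1 bdiff f t + k.+1%:R * iter k bdiff f (t - 1).
Proof.
elim: k t => [|k IHk] t; first by rewrite /= /bdiff; ring.
rewrite iterS {1}/bdiff !IHk /= /bdiff -[k.+2%:R]natr1; ring.
Qed.

Lemma tpowS c a : tpow c a.+1 = fun t => t * tpow c a t.
Proof. by apply/funext => t; rewrite /tpow; case: ifP; rewrite ?mulr0// exprS. Qed.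

(** The Cox-de Boor recurrence in this normalization. *)
Lemma bsplineS c a t :
  bspline c a.+1 t = t * bspline c a t + (a.+2%:R - t) * bspline c a (t - 1).
Proof.
rewrite /bspline tpowS iter_bdiff_mulX (iterS a.+1) /bdiff; ring.
Qed.

Lemma bspline_out c a t : t < 0 \/ a.+1%:R < t -> bspline c a t = 0.
Proof.
elim: a t => [|a IHa] t ht; last first.
  have -> : bspline c a.+1 t = t * bspline c a t + (a.+2%:R - t) * bspline c a (t - 1).
    exact: bsplineS.
  have e : a.+1%:R + 1 = a.+2%:R :> R := natr1 _.
  by rewrite !IHa ?mulr0 ?addr0//; case: ht => ?; [left|right|left|right]; lra.
rewrite /bspline /= /bdiff /tpow !expr0; case: ht => ht; case: c.
- by rewrite !ifF ?subrr//; apply/negbTE; rewrite -leNgt; lra.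
- by rewrite !ifF ?subrr//; apply/negbTE; rewrite -ltNge; lra.
- by rewrite !ifT ?subrr//; lra.
- by rewrite !ifT ?subrr//; lra.
Qed.

(** In the recurrence, the factors [t] and [a.+2%:R - t] are nonnegative wherever the splines they
    multiply are nonzero. *)
Lemma bspline_ge0 c a t : 0 <= bspline c a t.
Proof.
elim: a t => [|a IHa] t.
  rewrite /bspline /= /bdiff /tpow !expr0; case: c; do !case: ifP; rewrite ?subrr ?subr0 //.
  - by move=> h /negbT; rewrite -leNgt; lra.
  - by move=> h /negbT; rewrite -ltNge; lra.
rewrite bsplineS addr_ge0//.
  case: (ltP t 0) => t0; last by rewrite mulr_ge0.
  by rewrite bspline_out ?mulr0//; left.
case: (ltP a.+2%:R t) => ta; last by rewrite mulr_ge0// subr_ge0.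
by rewrite bspline_out ?mulr0//; right; have e : a.+1%:R + 1 = a.+2%:R :> R := natr1 _; lra.
Qed.

(** The neutral factor of a zero coordinate that is not removed and carries no linear form. *)
Lemma bspline00 : bspline false 0 0 = 1.
Proof. by rewrite /bspline /= /bdiff /tpow !expr0 lexx ifF ?subr0//; apply/negbTE; lra. Qed.

Lemma iter_bdiff_neg f (k : nat) :
  (forall t, t < 0 -> f t = 0) -> forall t, t < 0 -> iter k bdiff f t = 0.
Proof.
move=> f0; elim: k => //= k IHk t t0; rewrite /bdiff !IHk ?subrr//; lra.
Qed.

Lemma tpow_neg c a t : t < 0 -> tpow c a t = 0.
Proof. by move=> t0; rewrite /tpow; case: c; rewrite ifF//; apply/negbTE; lra. Qed.

End BSplines.

(** * Sums over the lattice points of a simplicial cone *)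

Section LatticeSums.
Local Open Scope classical_set_scope.
Variables (R : realType) (n D : nat) (U : 'M[R]_(n, D)) (g : nat).
Hypothesis g_gt0 : (0 < g)%N.
Hypothesis U_int : forall i, integral_point (row i U).
Implicit Types (l : 'rV[R]_n) (F : {set 'I_n}) (N : int) (phi : 'I_n -> R -> R).

Definition slice (K : {set 'I_n}) N : set 'rV[int]_D :=
  [set x | exists l, [/\ supported K l, forall i, 0 <= l 0 i,
     g%:R * \sum_i l 0 i = N%:~R & map_mx intr x = l *m U]].

Lemma finite_slice K N : finite_set (slice K N).
Proof.
(* As [g] is at least 1, the coordinates of [l] are at most |N|, which confines the entries of [x]
   to [-B, B]. *)
pose M : R := \sum_i \sum_j `|U i j|; pose B := (Num.Def.trunc (`|N|%:R * M)).+1.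
apply: (@sub_finite_set _ _ ((fun z : 'rV['I_(B + B).+1]_D =>
    \row_j ((z 0 j)%:Z - B%:Z)) @` [set: 'rV['I_(B + B).+1]_D])); last first.
  exact/finite_image/finite_finset.
move=> x [l [_ l0 lN lU]].
have Sl : \sum_i l 0 i <= `|N|%:R.
  have g1 : (1 : R) <= g%:R by rewrite (ler_nat _ 1).
  have S0 : 0 <= \sum_i l 0 i by apply: sumr_ge0.
  apply: (@le_trans _ _ (g%:R * \sum_i l 0 i)); first by rewrite ler_peMl.
  rewrite lN -[`|N|%:R]/(`|N|%N%:Z%:~R) ler_int lez_abs//.
have li i : l 0 i <= `|N|%:R.
  by apply: le_trans Sl; rewrite (bigD1 i)//= lerDl sumr_ge0.
have xB j : `|x 0 j| <= B%:Z.
  rewrite -(ler_int R) intr_norm.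
  have -> : (x 0 j)%:~R = (l *m U) 0 j by rewrite -lU mxE.
  apply: (@le_trans _ _ (`|N|%:R * M)); last by rewrite ltW// truncnS_gt.
  rewrite mxE (le_trans (ler_norm_sum _ _ _))// /M mulr_sumr ler_sum// => i _.
  rewrite normrM (ger0_norm (l0 i)) ler_pM//.
  by rewrite (bigD1 j)//= lerDl sumr_ge0.
exists (\row_j inord (absz (x 0 j + B%:Z))) => //.
apply/rowP => j; rewrite !mxE; have := xB j; rewrite ler_norml => /andP[x1 x2].
have x3 : 0 <= x 0 j + B%:Z by rewrite -lerBlDr sub0r.
rewrite inordK; first by rewrite gez0_abs// addrK.
by rewrite ltnS -lez_nat gez0_abs// PoszD lerD2r.
Qed.

(** Negative coordinates are allowed so that translation by a generator maps one such set onto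
    another; summands that vanish there restore finiteness. *)
Definition Lam F N : set 'rV[R]_n := [set l | [/\ supported F l,
  integral_point (l *m U) & g%:R * \sum_i l 0 i = N%:~R]].

Definition Lam_nn F N : set 'rV[R]_n := Lam F N `&` [set l | forall i, 0 <= l 0 i].

Lemma finite_Lam_nn F N : optimal U F -> finite_set (Lam_nn F N).
Proof.
move=> optF; apply: (@sub_finite_set _ _ ((fun x =>
    xget 0 [set l | supported F l /\ l *m U = map_mx intr x]) @` slice F N)); last first.
  exact/finite_image/finite_slice.
move=> l [[sl [x lx] lN] l0]; exists x; first by exists l.
by case: xgetP => [l' _ [sl' l'x]|/(_ l)[]//]; apply: (optimal_inj optF); rewrite ?lx.
Qed.

Definition lat F N phi : R := \sum_(l \in Lam F N) \prod_(i in F) phi i (l 0 i).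

Lemma lat_nn F N phi : (forall i t, i \in F -> t < 0 -> phi i t = 0) ->
  lat F N phi = \sum_(l \in Lam_nn F N) \prod_(i in F) phi i (l 0 i).
Proof.
move=> phi0; rewrite /lat; symmetry; apply: fsbig_widen => [l []//|].
move=> l [lL nl]; have [i li] : exists i, l 0 i < 0.
  apply/existsP; apply: contraT => /existsPn h; case: nl; split=> // i /=.
  by rewrite leNgt h.
case: lL => sl _ _; have iF : i \in F by apply: contraTT li => /sl ->; rewrite ltxx.
by rewrite /= (bigD1 i)//= phi0// mul0r.
Qed.

Lemma lat_ge0 F N phi : (forall i t, i \in F -> 0 <= phi i t) -> 0 <= lat F N phi.
Proof. by move=> phi0; apply: fsumr_ge0 => l _; apply: prodr_ge0 => i /phi0. Qed.

Lemma shift_Lam F N i l : i \in F ->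
  Lam F (N - g%:Z) (l - delta_mx 0 i) <-> Lam F N l.
Proof.
move=> iF; have shift_sup l' e : supported F l' -> supported F (l' + e *: delta_mx 0 i).
  move=> sl j jF; rewrite !mxE sl// add0r eqxx /=.
  by case: eqP jF => [->|]; rewrite ?iF// mulr0.
have shift_int l' (e : int) : integral_point (l' *m U) ->
    integral_point ((l' + e%:~R *: delta_mx 0 i) *m U).
  case=> x lx; have [z uz] := U_int i; exists (x + e *: z).
  by rewrite mulmxDl -scalemxAl -rowE lx uz map_mxD; congr (_ + _); apply/rowP => j;
    rewrite !mxE /= intrM.
have shift_sum l' e : \sum_j (l' + e *: delta_mx 0 i) 0 j = \sum_j l' 0 j + e.
  transitivity (\sum_j (l' 0 j + (if j == i then e else 0))).
    by apply: eq_bigr => j _; rewrite !mxE eqxx /=; case: eqP; rewrite ?mulr1 ?mulr0.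
  by rewrite big_split /= -big_mkcond big_pred1_eq.
have lE : l - delta_mx 0 i = l + (-1)%:~R *: delta_mx 0 i by rewrite scaleN1r.
have lE' : l = (l - delta_mx 0 i) + 1%:~R *: delta_mx 0 i by rewrite scale1r subrK.
split=> -[sl il Nl].
  rewrite lE'; split; [exact: shift_sup|exact: shift_int|].
  by rewrite shift_sum mulrDr Nl mulr1 rmorphB /= subrK.
rewrite lE; split; [exact: shift_sup|exact: shift_int|].
by rewrite shift_sum mulrDr Nl mulrN1 rmorphB.
Qed.

(** On coefficients, this is multiplication of the generating function by 1 - t^g. *)
Definition nab (a : int -> R) N : R := a N - a (N - g%:Z).

(** Translation by u_i turns the sum at [N - g] into a sum at [N] with the argument of [phi i]
    shifted by one. The choice of [i] in [F] is free, so differences can be distributed among the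
    coordinates at will. *)
Lemma lat_nab F phi i : optimal U F -> i \in F ->
    (forall i t, i \in F -> t < 0 -> phi i t = 0) ->
  nab (fun N => lat F N phi) =
  (fun N => lat F N (fun j => if j == i then bdiff (phi j) else phi j)).
Proof.
move=> optF iF phi0; apply/funext => N; rewrite /nab.
pose phi' (j : 'I_n) t := if j == i then phi j (t - 1) else phi j t.
have phi'0 j t : j \in F -> t < 0 -> phi' j t = 0.
  by move=> jF t0; rewrite /phi'; case: ifP => _; apply: phi0 => //; lra.
have -> : lat F (N - g%:Z) phi = lat F N phi'.
  rewrite /lat (reindex_fsbig (fun l => l - delta_mx 0 i) (Lam F N)); last first.
    split=> [l|l l' _ _ /addIr//|l lL]; first by move/(shift_Lam _ _ iF).
    exists (l + delta_mx 0 i); last by rewrite addrK.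
    by apply/(shift_Lam _ _ iF); rewrite addrK.
  apply: eq_fsbigr => l _; apply: eq_bigr => j jF; rewrite /phi' !mxE eqxx /=.
  by case: eqP; rewrite ?subr0.
have phi''0 j t : j \in F -> t < 0 ->
    (if j == i then bdiff (phi j) else phi j) t = 0.
  by move=> jF t0; case: ifP => _; rewrite /bdiff !phi0 ?subrr//; lra.
rewrite !lat_nn// !fsbig_finite; try exact: finite_Lam_nn.
rewrite -sumrB; apply: eq_bigr => l _.
rewrite !(bigD1 i iF) /= /phi' !eqxx /bdiff.
rewrite [X in _ - _ * X](eq_bigr (fun j => phi j (l 0 j))); last first.
  by move=> j /andP[_ /negPf->].
rewrite [X in _ = _ * X](eq_bigr (fun j => phi j (l 0 j))) -?mulrBl//.
by move=> j /andP[_ /negPf->].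
Qed.

Lemma lat_iter_nab F phi (s : seq 'I_n) : optimal U F -> {subset s <= F} ->
    (forall i t, i \in F -> t < 0 -> phi i t = 0) ->
  iter (size s) nab (fun N => lat F N phi) =
  (fun N => lat F N (fun i => iter (count_mem i s) (@bdiff R) (phi i))).
Proof.
move=> optF sF phi0; elim: s sF => [|i s IHs] sF //=.
rewrite IHs; last by move=> j js; apply: sF; rewrite inE js orbT.
rewrite (@lat_nab F _ i) //; first last.
- by move=> j t jF; apply: iter_bdiff_neg => t' t'0; apply: phi0.
- by apply: sF; rewrite inE eqxx.
apply/funext => N; congr lat; apply/funext => j; rewrite eq_sym.
by case: eqP => //= _; rewrite add1n iterS.
Qed.

End LatticeSums.

(** * The numerator of the weighted generating function of a cone *)

Section ConeSeries.
Local Open Scope classical_set_scope.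
Variables (R : realType) (n D : nat) (U : 'M[R]_(n, D)) (g : nat) (q : 'I_D).
Hypothesis g_gt0 : (0 < g)%N.
Hypothesis U_int : forall i, integral_point (row i U).
Hypothesis U_ht : forall i, U i q = g%:R.
Variables (m : nat) (w : 'rV[R]_D -> R) (c : 'I_m -> 'I_n -> R).
Hypothesis w_prod : forall l, w (l *m U) = \prod_j \sum_i l 0 i * c j i.
Hypothesis c_ge0 : forall j i, 0 <= c j i.
Implicit Types (l : 'rV[R]_n) (F A : {set 'I_n}) (N : int) (k : nat).

Local Notation Lam := (Lam U g).
Local Notation Lam_nn := (Lam_nn U g).
Local Notation lat := (lat U g).
Local Notation nab := (nab g).
Local Notation slice := (slice U g).
Local Notation chamber := (chamber U).
Local Notation removed := (removed U).
Local Notation rk := (rk U).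
Local Notation below := (@below n).

Lemma nab_sum (I : finType) (P : pred I) (b : I -> R) (h : I -> int -> R) (e : nat) :
  iter e nab (fun N => \sum_(i | P i) b i * h i N) =
  (fun N => \sum_(i | P i) b i * iter e nab (h i) N).
Proof.
elim: e => //= e ->; apply/funext => N; rewrite /nab -sumrB.
by apply: eq_bigr => i _; rewrite mulrBr.
Qed.

Lemma optimalS F A : A \subset F -> optimal U F -> optimal U A.
Proof.
move=> sAF optF v vU v0; apply: optF => // j jF; apply: v0.
by apply: contra jF; apply: fintype.subsetP.
Qed.

(** A map [f] picks one coordinate from each of the [m] linear forms; this is the exponent of
    coordinate [i] in the resulting monomial. *)
Definition mult (f : {ffun 'I_m -> 'I_n}) (i : 'I_n) : nat := count_mem i (codom f).

Definition cell_sum F A N : R :=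
  \sum_(l \in Lam F N `&` [set l | halfopen F A l]) w (l *m U).

Lemma prod_mult F (f : {ffun 'I_m -> 'I_n}) l : f \in ffun_on (mem F) ->
  \prod_j l 0 (f j) = \prod_(i in F) l 0 i ^+ mult f i.
Proof.
move=> /ffun_onP fF; rewrite (partition_big f (mem F)) /=; last by move=> j _; apply: fF.
apply: eq_bigr => i _; rewrite (eq_bigr (fun=> l 0 i)); last by move=> j /eqP->.
rewrite prodr_const; congr (_ ^+ _); rewrite /mult /codom /image_mem count_map.
by rewrite cardE /enum_mem size_filter count_filter; apply: eq_count => j /=; rewrite andbT.
Qed.

(** Expanding the product of linear forms gives monomials indexed by [f]; truncating the powers
    encodes the half-open inequalities. *)
Lemma cell_sumE F A N : optimal U F ->
  cell_sum F A N = \sum_(f in ffun_on (mem F)) (\prod_j c j (f j)) *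
    lat F N (fun i => tpow (i \in A) (mult f i)).
Proof.
move=> optF; rewrite /cell_sum fsbig_mkcondr.
pose term l := \sum_(f in ffun_on (mem F)) (\prod_j c j (f j)) *
  \prod_(i in F) tpow (i \in A) (mult f i) (l 0 i).
transitivity (\sum_(l \in Lam F N) term l).
  apply: eq_fsbigr => l; rewrite inE => -[sl _ _].
  case: ifPn => [|/negP]; rewrite inE /= => ho.
    rewrite w_prod (eq_bigr (fun j => \sum_(i in F) l 0 i * c j i)); last first.
      move=> j _; rewrite [RHS]big_mkcond /=; apply: eq_bigr => i _.
      by case: ifPn => // /sl ->; rewrite mul0r.
    rewrite bigA_distr_big /=; apply: eq_bigr => f fF.
    rewrite big_split /= mulrC (prod_mult _ fF); congr (_ * _).
    apply: eq_bigr => i iF; rewrite /tpow; case: ho => _ /(_ i iF).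
    by case: ifP => _ ->.
  symmetry; apply: big1 => f _.
  suff [i iF Hi] : exists2 i, i \in F & ~~ (if i \in A then 0 < l 0 i else 0 <= l 0 i).
    by rewrite (bigD1 i)//= /tpow (negPf Hi) mul0r mulr0.
  apply/exists_inP; apply: contra_notT ho => /exists_inPn h; split=> // j jF.
  by have := h j jF; rewrite negbK.
have -> : \sum_(l \in Lam F N) term l = \sum_(l \in Lam_nn F N) term l.
  symmetry; apply: fsbig_widen => [l []//|] l [lL nl]; rewrite /= /term big1// => f _.
  have [i li] : exists i, l 0 i < 0.
    apply/existsP; apply: contraT => /existsPn h; case: nl; split=> // i /=.
    by rewrite leNgt h.
  case: lL => sl _ _; have iF : i \in F by apply: contraTT li => /sl ->; rewrite ltxx.
  by rewrite (bigD1 i)//= tpow_neg// mul0r mulr0.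
have fin : finite_set (Lam_nn F N) by apply: finite_Lam_nn.
rewrite fsbig_finite//= /term exchange_big /=; apply: eq_bigr => f fF.
rewrite lat_nn; last by move=> i t _; apply: tpow_neg.
by rewrite fsbig_finite//= mulr_sumr.
Qed.

(** For the monomial of [f], one difference is spent on each coordinate of [F] and one more, for
    each linear form, on the coordinate that [f] assigns to it. The total is the same for every [f],
    and coordinate [i] receives [mult f i] + 1 of them. *)
Lemma iter_cell_sum F A : optimal U F ->
  iter (#|F| + m) nab (cell_sum F A) =
  (fun N => \sum_(f in ffun_on (mem F)) (\prod_j c j (f j)) *
    lat F N (fun i => bspline (i \in A) (mult f i))).
Proof.
move=> optF; rewrite (_ : cell_sum F A = fun N => \sum_(f in ffun_on (mem F))
    (\prod_j c j (f j)) * lat F N (fun i => tpow (i \in A) (mult f i))); last first.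
  by apply/funext => N; apply: cell_sumE.
rewrite nab_sum; apply/funext => N; apply: eq_bigr => f fF; congr (_ * _).
have -> : (#|F| + m)%N = size (enum F ++ codom f).
  by rewrite size_cat -cardE size_codom card_ord.
rewrite lat_iter_nab//.
- apply: eq_fsbigr => l _; apply: eq_bigr => i iF; rewrite count_cat.
  by rewrite (count_uniq_mem _ (enum_uniq _)) mem_enum iF add1n.
- move=> i; rewrite mem_cat mem_enum => /orP[//|/codomP[j ->]].
  by have /ffun_onP := fF; apply.
- by move=> i t _; apply: tpow_neg.
Qed.

Definition cone_sum k N : R := \sum_(x \in slice (below k) N) w (map_mx intr x).

Definition meets k F : Prop := chamber F /\ exists l l1,
  [/\ halfopen F (removed F) l, l *m U = l1 *m U, forall i, 0 <= l1 0 i &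
      supported (below k) l1].

Lemma height l : (l *m U) 0 q = g%:R * \sum_i l 0 i.
Proof.
by rewrite mxE mulr_sumr; apply: eq_bigr => i _; rewrite U_ht mulrC.
Qed.

Definition cell F : set 'rV[int]_D := [set x | chamber F /\
  exists2 l, halfopen F (removed F) l & map_mx intr x = l *m U].

(** By [chamber_face], coordinates of these points vanish beyond [k]; conversely such zeros are
    admissible, as no removed facet of the piece lies beyond [k]. *)
Lemma cell_sum_meets k F N : meets k F ->
  \sum_(x \in slice (below k) N `&` cell F) w (map_mx intr x) =
  cell_sum (F :&: below k) (removed F) N.
Proof.
move=> [chF [l2 [l3 [ho2 eq23 l30 sl3]]]].
have [_ sremk _] := chamber_face chF ho2 eq23 l30 sl3.
(* On integral vectors the floor merely converts real entries back to integers. *)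
pose h l : 'rV[int]_D := map_mx Num.floor (l *m U).
have hK l : integral_point (l *m U) -> map_mx intr (h l) = l *m U.
  by case=> x lx; rewrite /h lx -map_mx_comp; apply/rowP => j; rewrite !mxE /= intrKfloor.
rewrite /cell_sum (reindex_fsbig h
  (Lam (F :&: below k) N `&` [set l | halfopen (F :&: below k) (removed F) l])).
  by apply: eq_fsbigr => l; rewrite inE => -[[_ il _] _]; rewrite hK.
have optF : optimal U F by case: chF => rows [].
have widen l : halfopen (F :&: below k) (removed F) l -> halfopen F (removed F) l.
  move=> [sl ho]; split=> [j jF|j jF].
    by apply: sl; rewrite finset.in_setI (negPf jF).
  case: (boolP (j \in below k)) => jk; first by apply: ho; rewrite finset.in_setI jF.
  case: ifPn => jr.
    by case/negP: jk; apply: (fintype.subsetP sremk); rewrite finset.in_setI jF.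
  by rewrite sl// finset.in_setI (negPf jk) andbF.
split.
- move=> l [[sl il Nl] ho] /=; split; last first.
    by split=> //; exists l; [exact: widen|exact: hK].
  exists l; split=> //; last exact: hK.
    by move=> j jk; apply: sl; rewrite finset.in_setI (negPf jk) andbF.
  move=> i; case: (boolP (i \in F :&: below k)) => iF; last by rewrite sl.
  by case: ho => _ /(_ i iF); case: ifP => // _ /ltW.
- move=> l l'; rewrite !inE => -[[sl il _] _] [[sl' il' _] _] hh.
  apply: (optimal_inj (optimalS (subsetIl F (below k)) optF)) => //.
  by rewrite -hK// hh hK.
move=> x [[l1 [sl1 l10 Nl1 xl1]] [_ [l ho xl]]].
have eqU : l *m U = l1 *m U by rewrite -xl.
have [slk _ _] := chamber_face chF ho eqU l10 sl1.
have [sl pos] := ho.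
exists l; last first.
  have /matrixP e : map_mx intr (h l) = map_mx intr x :> 'rV[R]_D.
    by rewrite hK -?xl//; exists x.
  by apply/matrixP => i j; have := e i j; rewrite !mxE => /intr_inj.
have slFk : supported (F :&: below k) l.
  by move=> j; rewrite finset.in_setI negb_and => /orP[/sl|/slk].
split; split=> //.
- by exists x; rewrite xl.
- by rewrite -height eqU height.
by move=> j; rewrite finset.in_setI => /andP[/pos].
Qed.

Lemma cone_sum_cells k N :
  cone_sum k N = \sum_(F | `[< meets k F >]) cell_sum (F :&: below k) (removed F) N.
Proof.
have fin : finite_set (slice (below k) N) by apply: finite_slice.
rewrite /cone_sum.
transitivity (\sum_(x \in slice (below k) N)
    \sum_(F | `[< meets k F >]) (if x \in cell F then w (map_mx intr x) else 0)).
  apply: eq_fsbigr => x; rewrite inE => -[l1 [sl1 l10 Nl1 xl1]].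
  have [F [l [chF ho eqU]]] := chamber_cover U l10.
  rewrite (bigD1 F) /=; last by apply/asboolP; split=> //; exists l, l1.
  rewrite ifT; last by rewrite inE; split=> //; exists l; rewrite ?eqU.
  rewrite big1 ?addr0// => F' /andP[_ F'F]; rewrite ifF//; apply/negbTE; apply/negP.
  rewrite inE => -[chF' [l' ho' xl']].
  have [FF' _] := chamber_disjoint chF chF' ho ho' (etrans eqU (etrans (esym xl1) xl')).
  by rewrite FF' eqxx in F'F.
rewrite fsbig_finite// exchange_big /=; apply: eq_bigr => F /asboolP mF.
by rewrite -fsbig_finite// -fsbig_mkcondr cell_sum_meets.
Qed.

Definition numerator k N : R := iter (rk (below k) + m) nab (cone_sum k) N.

(** All pieces have the same number [rk (below k)] of generators, so one exponent turns every
    truncated power into a B-spline. *)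
Lemma numeratorE k N : numerator k N =
  \sum_(F | `[< meets k F >]) \sum_(f in ffun_on (mem (F :&: below k)))
    (\prod_j c j (f j)) *
    lat (F :&: below k) N (fun i => bspline (i \in removed F) (mult f i)).
Proof.
rewrite /numerator (_ : cone_sum k = fun N => \sum_(F | `[< meets k F >])
    1 * cell_sum (F :&: below k) (removed F) N); last first.
  apply/funext => N'; rewrite cone_sum_cells.
  by apply: eq_bigr => F _; rewrite mul1r.
rewrite nab_sum; apply: eq_bigr => F /asboolP[chF [l [l1 [ho eqU l10 sl1]]]].
have [_ _ <-] := chamber_face chF ho eqU l10 sl1; rewrite mul1r iter_cell_sum//.
by apply: optimalS (subsetIl F (below k)) _; case: chF => rows [].
Qed.

Lemma numerator_ge0 k N : 0 <= numerator k N.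
Proof.
rewrite numeratorE; apply: sumr_ge0 => F _; apply: sumr_ge0 => f _.
apply: mulr_ge0; first by apply: prodr_ge0 => j _; apply: c_ge0.
by apply: lat_ge0 => i t _; apply: bspline_ge0.
Qed.

(** The splines vanish beyond m + 1, and a height above g n (m + 1) forces one of the [n]
    coordinates beyond m + 1. *)
Lemma numerator_out k N : (g * (n * m.+1))%N%:Z < N -> numerator k N = 0.
Proof.
move=> NN; rewrite numeratorE big1// => F _; rewrite big1// => f _.
suff -> : forall phi, phi = (fun i => bspline (i \in removed F) (mult f i)) ->
  lat (F :&: below k) N phi = 0 by rewrite ?mulr0.
move=> phi phiE; apply: fsbig1 => l [sl _ Nl].
have [i li] : exists i, m.+1%:R < l 0 i.
  apply/existsP; apply: contraTT NN => /existsPn h; rewrite -leNgt -(ler_int R) -Nl.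
  rewrite -[X in _ <= X]/((g * (n * m.+1))%:R) natrM ler_wpM2l//.
  rewrite (@le_trans _ _ (\sum_(i < n) m.+1%:R))//.
    by apply: ler_sum => i _; rewrite leNgt h.
  by rewrite sumr_const card_ord natrM mulr_natl.
have iF : i \in F :&: below k.
  by apply: contraTT li => /sl ->; rewrite -leNgt.
rewrite (bigD1 i)//= phiE bspline_out ?mul0r//; right.
apply: le_lt_trans li; rewrite ler_nat ltnS.
by rewrite (leq_trans (count_size _ _))// size_codom card_ord.
Qed.

(** Each choice of chamber, map [f] and lattice point counted for [k1] is counted for [k2] with the
    same value; the remaining terms are nonnegative. *)
Lemma numerator_mono k1 k2 N : (k1 <= k2)%N -> numerator k1 N <= numerator k2 N.
Proof.
move=> k12; have s12 : below k1 \subset below k2.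
  by apply/fintype.subsetP => i; rewrite !finset.in_set => /leq_trans; apply.
have meets12 F : meets k1 F -> meets k2 F.
  move=> [chF [l [l1 [ho eqU l10 sl1]]]]; split=> //; exists l, l1; split=> // j jk.
  by apply: sl1; apply: contra jk; apply: fintype.subsetP.
have c0 (f : {ffun 'I_m -> 'I_n}) : 0 <= \prod_j c j (f j).
  by apply: prodr_ge0 => j _; apply: c_ge0.
have lat0 F (f : {ffun 'I_m -> 'I_n}) k :
    0 <= lat (F :&: below k) N (fun i => bspline (i \in removed F) (mult f i)).
  by apply: lat_ge0 => i t _; apply: bspline_ge0.
rewrite !numeratorE big_mkcond [leRHS]big_mkcond /=; apply: ler_sum => F _.
case: asboolP => [m1|_]; last first.
  by case: ifP => // _; apply: sumr_ge0 => f _; apply: mulr_ge0.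
rewrite ifT; last by apply/asboolP; apply: meets12.
rewrite big_mkcond [leRHS]big_mkcond /=; apply: ler_sum => f _.
case: (boolP (f \in ffun_on (mem (F :&: below k1)))) => f1; last first.
  by case: ifP => // _; apply: mulr_ge0.
have sF : F :&: below k1 \subset F :&: below k2 by apply: finset.setIS.
rewrite ifT; last first.
  by apply/ffun_onP => j; apply: (fintype.subsetP sF); have /ffun_onP := f1; apply.
apply: ler_wpM2l => //.
have [chF [l [l1 [ho eqU l10 sl1]]]] := m1.
have [_ sremk _] := chamber_face chF ho eqU l10 sl1.
have optF : optimal U F by case: chF => rows [].
set phi := fun i => _.
have phi_neg (i : 'I_n) t : t < 0 -> phi i t = 0.
  by move=> t0; apply: bspline_out; left.
have -> : lat (F :&: below k1) N phi =
    \sum_(l \in Lam_nn (F :&: below k1) N) \prod_(i in F :&: below k2) phi i (l 0 i).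
  rewrite lat_nn; last by move=> i t _; apply: phi_neg.
  apply: eq_fsbigr => l'; rewrite inE => -[[sl _ _] _].
  (* The coordinates between [k1] and [k2] are zero, not removed and carry no linear form, so their
     factors are 1. *)
  rewrite [RHS](big_setID (F :&: below k1)) /= (finset.setIidPr sF).
  rewrite [X in _ * X]big1 ?mulr1// => i; rewrite finset.in_setD => /andP[i1 i2].
  have iF : i \in F by move: i2; rewrite finset.in_setI => /andP[].
  have ik : i \notin below k1 by move: i1; rewrite finset.in_setI iF.
  rewrite sl// /phi (_ : i \in removed F = false); last first.
    by apply: contraNF ik => ir; apply: (fintype.subsetP sremk); rewrite finset.in_setI iF.
  rewrite (_ : mult f i = 0%N) ?bspline00//; apply/count_memPn.
  apply: contra i1 => /codomP[j ->]; have /ffun_onP := f1; exact.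
rewrite lat_nn; last by move=> i t _; apply: phi_neg.
have fin2 : finite_set (Lam_nn (F :&: below k2) N).
  by apply: finite_Lam_nn => //; apply: optimalS (subsetIl _ _) optF.
rewrite [leRHS](fsbigID (Lam_nn (F :&: below k1) N))//=.
rewrite (_ : Lam_nn _ _ `&` _ = Lam_nn (F :&: below k1) N); last first.
  apply/seteqP; split=> [l' []//|l' h]; split=> //.
  case: h => -[sl il Nl] l0; split=> //; split=> // j jF; apply: sl.
  by apply: contra jF; apply: fintype.subsetP.
rewrite lerDl; apply: fsumr_ge0 => l' _; apply: prodr_ge0 => i _.
exact: bspline_ge0.
Qed.

End ConeSeries.

(** * Polytopes as hulls of their vertices *)

Section Gordan.
Variables (R : realFieldType) (d : nat).
Implicit Types (u v : 'rV[R]_d) (a b : 'cV[R]_d) (s : seq 'rV[R]_d).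

Definition dot v a : R := (v *m a) 0 0.

Lemma dotDl u v a : dot (u + v) a = dot u a + dot v a.
Proof. by rewrite /dot mulmxDl mxE. Qed.

Lemma dotBl u v a : dot (u - v) a = dot u a - dot v a.
Proof. by rewrite /dot mulmxBl !mxE. Qed.

Lemma dotZl (x : R) u a : dot (x *: u) a = x * dot u a.
Proof. by rewrite /dot -scalemxAl mxE. Qed.

Lemma dotBr u a b : dot u (a - b) = dot u a - dot u b.
Proof. by rewrite /dot mulmxBr !mxE. Qed.

Lemma dotZr (x : R) u a : dot u (x *: a) = x * dot u a.
Proof. by rewrite /dot -scalemxAr mxE. Qed.

Lemma dot_suml (I : Type) (r : seq I) (P : pred I) (E : I -> 'rV[R]_d) a :
  dot (\sum_(i <- r | P i) E i) a = \sum_(i <- r | P i) dot (E i) a.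
Proof. by rewrite /dot mulmx_suml summxE. Qed.

Lemma dot_tr_gt0 v : v != 0 -> 0 < dot v v^T.
Proof.
move=> v0; rewrite /dot mxE lt_neqAle eq_sym.
have sq0 j : 0 <= v 0 j * v^T j 0 by rewrite mxE -expr2 sqr_ge0.
rewrite sumr_ge0 ?andbT//.
apply: contra v0 => /eqP/psumr_eq0P h; apply/eqP/rowP => j.
by have := h (fun j _ => sq0 j) j isT; rewrite !mxE => /eqP; rewrite mulf_eq0 orbb => /eqP.
Qed.

(** Subtracting a small positive multiple of [v^T] makes the value at [v] negative and preserves the
    finitely many strict inequalities. *)
Lemma perturb s v b : v != 0 -> dot v b = 0 -> (forall u, u \in s -> dot u b < 0) ->
  exists b', forall u, u \in v :: s -> dot u b' < 0.
Proof.
move=> v0 vb sb.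
suff [e e0 he] : exists2 e : R, 0 < e &
    forall u, u \in s -> forall e', 0 < e' -> e' <= e -> dot u b - e' * dot u v^T < 0.
  exists (b - e *: v^T) => u; rewrite inE dotBr dotZr => /predU1P[->|us].
    by rewrite vb sub0r oppr_lt0 mulr_gt0// dot_tr_gt0.
  exact: he.
elim: s sb => [|u s IHs] sb; first by exists 1.
have [|e e0 he] := IHs; first by move=> x xs; apply: sb; rewrite inE xs orbT.
have ub : dot u b < 0 by apply: sb; rewrite inE eqxx.
pose t := - dot u b / (1 + `|dot u v^T|).
have nv : 0 <= `|dot u v^T| by [].
have t0 : 0 < t by rewrite divr_gt0 ?oppr_gt0// ltr_wpDr.
exists (Num.min e t); first by rewrite lt_min e0.
move=> x; rewrite inE => /predU1P[->|xs] e' e'0; rewrite le_min => /andP[e'e e't]; last exact: he.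
have : e' * (1 + `|dot u v^T|) <= - dot u b by rewrite -ler_pdivlMr// ltr_wpDr.
have : - (e' * dot u v^T) <= e' * `|dot u v^T|.
  by rewrite -mulrN ler_pM2l// -normrN ler_norm.
rewrite mulrDr mulr1; lra.
Qed.

(** Gordan's theorem of the alternative, by induction on the number of vectors. If the functional
    [a] found for the tail is positive on the head [v], the tail is projected along [v] to the
    kernel of [a] and the induction hypothesis is used again. *)
Lemma gordan s : (exists a, forall u, u \in s -> dot u a < 0) \/
  exists c : nat -> R, [/\ forall i, 0 <= c i, 0 < \sum_(0 <= i < size s) c i &
    \sum_(0 <= i < size s) c i *: s`_i = 0].
Proof.
elim: {s}(size s) {-2}s (erefl (size s)) => [|N IHN] [|v s] //= ssz.
  by left; exists 0.
move: ssz => [ssz].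
have [->|v0] := eqVneq v 0.
  right; exists (fun i => (i == 0%N)%:R); split=> [i||]; first exact: ler0n.
    by rewrite big_nat_recl//= big1 ?addr0.
  by rewrite big_nat_recl//= scale1r add0r big1// => i _; rewrite scale0r.
case: (IHN s ssz) => [[a sa]|[c [c0 c1 cs]]]; last first.
  right; exists (fun i => if i is i'.+1 then c i' else 0); split=> [[|i]//||].
    by rewrite big_nat_recl//= add0r.
  by rewrite big_nat_recl//= scale0r add0r.
case: (ltgtP (dot v a) 0) => va.
- by left; exists a => u; rewrite inE => /predU1P[->|/sa].
- pose f u := - (dot u a / dot v a).
  have f0 u : u \in s -> 0 <= f u.
    by move=> /sa ua; rewrite oppr_ge0 pmulr_lle0 ?invr_gt0// ltW.
  case: (IHN [seq u + f u *: v | u <- s]); rewrite ?size_map//.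
    (* Correcting [b] by a multiple of [a] makes it vanish on [v] and keeps its values on the
       projected vectors, where [a] is zero. *)
    move=> [b sb]; left; pose b' := b - (dot v b / dot v a) *: a.
    apply: (@perturb s v b') => //.
      by rewrite /b' dotBr dotZr divfK ?subrr// gt_eqF.
    move=> u us; have := sb (u + f u *: v) (map_f _ us).
    rewrite dotDl dotZl /b' dotBr dotZr /f.
    suff -> : dot u b - dot v b / dot v a * dot u a = dot u b + - (dot u a / dot v a) * dot v b.
      by [].
    by field; rewrite gt_eqF.
  move=> [c [c0 c1 cs]]; right.
  exists (fun i => if i is i'.+1 then c i' else
    \sum_(0 <= i < size s) c i * f s`_i).
  have h0 : 0 <= \sum_(0 <= i < size s) c i * f s`_i.
    by rewrite big_nat; apply: sumr_ge0 => i /andP[_ si]; rewrite mulr_ge0// f0// mem_nth.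
  split=> [[|i]//||]; first by rewrite big_nat_recl//= ltr_wpDl.
  rewrite big_nat_recl//= scaler_suml -big_split /= -[RHS]cs.
  apply: eq_big_nat => i /andP[_ si].
  by rewrite (nth_map 0)// scalerDr scalerA addrC.
- by left; apply: perturb sa.
Qed.

End Gordan.

Section Hulls.
Local Open Scope classical_set_scope.
Variables (R : realType) (d : nat).
Implicit Types (u v x : 'rV[R]_d) (s t : seq 'rV[R]_d) (P : set 'rV[R]_d).

Lemma convP s x : conv s x <-> exists a : nat -> R,
  [/\ forall i, 0 <= a i, \sum_(0 <= i < size s) a i = 1 &
      x = \sum_(0 <= i < size s) a i *: s`_i].
Proof.
split=> [[c [c0 c1 cx]]|[a [a0 a1 ax]]]; last first.
  by exists (fun i => a i); split=> //; rewrite -?a1 ?ax big_mkord.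
exists (fun i => if insub i is Some j then c j else 0); split=> [i||].
- by case: insub.
- by rewrite big_mkord -[RHS]c1; apply: eq_bigr => i _; rewrite valK.
- by rewrite big_mkord cx; apply: eq_bigr => i _; rewrite valK.
Qed.

Lemma mem_conv s v : v \in s -> conv s v.
Proof.
move=> vs; apply/convP; exists (fun i => (i == index v s)%:R).
have iv : (index v s < size s)%N by rewrite index_mem.
split=> [i||]; first exact: ler0n.
  rewrite big_mkord (bigD1 (Ordinal iv))//= eqxx big1 ?addr0// => i.
  by rewrite -val_eqE /= => /negPf->.
rewrite big_mkord (bigD1 (Ordinal iv))//= eqxx scale1r nth_index// big1 ?addr0// => i.
by rewrite -val_eqE /= => /negPf->; rewrite scale0r.
Qed.

Lemma conv_sub s t : (forall u, u \in s -> conv t u) -> conv s `<=` conv t.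
Proof.
move=> st x /convP[a [a0 a1 ->]].
have /choice[b hb] : forall i, exists b : nat -> R, (i < size s)%N ->
    [/\ forall j, 0 <= b j, \sum_(0 <= j < size t) b j = 1 &
        s`_i = \sum_(0 <= j < size t) b j *: t`_j].
  move=> i; case: (ltnP i (size s)) => si; last by exists (fun=> 0).
  by have /convP[b hb] := st _ (mem_nth 0 si); exists b.
apply/convP; exists (fun j => \sum_(0 <= i < size s) a i * b i j); split.
- move=> j; rewrite big_nat; apply: sumr_ge0 => i /andP[_ si].
  by rewrite mulr_ge0//; case: (hb i si).
- rewrite exchange_big /= -[RHS]a1; apply: eq_big_nat => i /andP[_ si].
  by rewrite -mulr_sumr; case: (hb i si) => _ -> _; rewrite mulr1.
under [RHS]eq_bigr do rewrite scaler_suml.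
rewrite exchange_big /=; apply: eq_big_nat => i /andP[_ si].
case: (hb i si) => _ _ ->; rewrite scaler_sumr.
by apply: eq_bigr => j _; rewrite scalerA.
Qed.

Lemma conv_lt s (a : 'cV[R]_d) (M : R) x :
  (forall u, u \in s -> dot u a < M) -> conv s x -> dot x a < M.
Proof.
move=> sa /convP[c [c0 c1 xE]]; rewrite -subr_gt0.
have -> : M - dot x a = \sum_(i < size s) c i * (M - dot s`_i a).
  rewrite xE dot_suml -[in LHS](mul1r M) -c1 mulr_suml -sumrB big_mkord.
  by apply: eq_bigr => i _; rewrite dotZl mulrBr.
have [i ci] : exists i : 'I_(size s), 0 < c i.
  apply/existsP; apply: contraT => /existsPn h; move: (@ltr01 R); rewrite -c1 big_mkord.
  by rewrite ltNge sumr_le0// => i _; rewrite leNgt h.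
have pos (j : 'I_(size s)) : 0 < M - dot s`_j a by rewrite subr_gt0 sa// mem_nth.
rewrite (bigD1 i)//= ltr_pwDl// ?mulr_gt0// sumr_ge0// => j _.
by rewrite mulr_ge0// ltW.
Qed.

Lemma exposed_lt s v (a : 'cV[R]_d) x :
    (forall u, u \in s -> u != v -> dot u a < dot v a) -> conv s x -> x <> v ->
  dot x a < dot v a.
Proof.
move=> sa /convP[c [c0 c1 xE]] xv; rewrite -subr_gt0.
have -> : dot v a - dot x a = \sum_(0 <= i < size s) c i * (dot v a - dot s`_i a).
  rewrite xE dot_suml -[in LHS](mul1r (dot v a)) -c1 mulr_suml -sumrB.
  by apply: eq_bigr => i _; rewrite dotZl mulrBr.
have pos i : (i < size s)%N -> 0 <= c i * (dot v a - dot s`_i a).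
  move=> si; rewrite mulr_ge0//; case: (eqVneq s`_i v) => [->|siv]; first by rewrite subrr.
  by rewrite subr_ge0 ltW// sa// mem_nth.
have [i ci] : exists i : 'I_(size s), (0 < c i) && (s`_i != v).
  apply/existsP; apply: contra_notT xv => /existsPn h.
  rewrite xE -[RHS]scale1r -c1 scaler_suml !big_mkord; apply: eq_bigr => i _.
  have := h i; rewrite negb_and negbK => /orP[|/eqP->//].
  by rewrite -leNgt => ci; rewrite (_ : c i = 0) ?scale0r//; apply/le_anti; rewrite ci c0.
case/andP: ci => ci siv; rewrite big_mkord (bigD1 i)//= ltr_pwDl//.
  by rewrite mulr_gt0// subr_gt0 sa// mem_nth.
by apply: sumr_ge0 => j _; apply: pos.
Qed.

(** Gordan's theorem for the differences [u - v]: a functional negative on all of them exposes [v],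
    and a dependency divided by its total weight writes [v] as a convex combination of the other
    points. *)
Lemma vertex_or_redundant s v : v \in s ->
  vertex (conv s) v \/ conv [seq u <- s | u != v] v.
Proof.
move=> vs; pose s1 := [seq u <- s | u != v].
case: (gordan [seq u - v | u <- s1]) => [[a ha]|[c [c0 c1 cE]]].
  left; split; first exact: mem_conv.
  exists a => x xP xv; apply: (exposed_lt _ xP xv) => u us uv.
  by rewrite -subr_lt0 -dotBl; apply: ha; apply: map_f; rewrite mem_filter uv.
right; apply/convP; rewrite size_map -/s1 in c1 cE *.
set C := \sum_(0 <= i < size s1) c i in c1.
exists (fun i => c i / C); split.
- by move=> i; rewrite divr_ge0// ltW.
- by rewrite -mulr_suml divff// gt_eqF.
apply: (scalerI (lt0r_neq0 c1)); rewrite scaler_sumr.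
transitivity (\sum_(0 <= i < size s1) c i *: s1`_i); last first.
  by apply: eq_bigr => i _; rewrite scalerA mulrC divfK// gt_eqF.
rewrite /C scaler_suml; apply/eqP; rewrite eq_sym -subr_eq0 -sumrB; apply/eqP; rewrite -[RHS]cE.
by apply: eq_big_nat => i /andP[_ si]; rewrite (nth_map 0)// scalerBr.
Qed.

Lemma conv_vertices s : exists t, conv t = conv s /\
  forall v, v \in t -> vertex (conv s) v.
Proof.
have [N] := ubnP (size s); elim: N s => // N IHN s sN.
case: (pselect (forall v, v \in s -> vertex (conv s) v)) => [h|]; first by exists s.
move=> /existsNP[v /not_implyP[vs nv]]; pose s1 := [seq u <- s | u != v].
have s1v : conv s1 v by case: (vertex_or_redundant vs).
have s1s : conv s1 = conv s.
  apply/seteqP; split; apply: conv_sub => u.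
    by rewrite mem_filter => /andP[_]; apply: mem_conv.
  move=> us; case: (eqVneq u v) => [->//|uv].
  by apply: mem_conv; rewrite mem_filter uv.
rewrite -s1s; apply: IHN; rewrite ltnS in sN; apply: leq_trans sN.
rewrite size_filter -(count_predC (pred1 v) s) -[ltnLHS]add0n ltn_add2r -has_count.
by apply/hasP; exists v => /=.
Qed.

Lemma leastP (A : set nat) n : A n -> A (least A) /\ forall k, A k -> (least A <= k)%N.
Proof.
move=> An; have exA : exists n, `[< A n >] by exists n; apply/asboolP.
rewrite /least; case: xgetP => [k _ []//|h].
case: (ex_minnP exA) => k /asboolP Ak mink; case: (h k); split=> // j Aj.
by apply: mink; apply/asboolP.
Qed.

Lemma rat_row_integral (v : 'rV[rat]_d) : exists2 q : nat, (0 < q)%N &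
  integral_point (q%:R *: map_mx ratr v : 'rV[R]_d).
Proof.
pose den j := absz (denq (v 0 j)); pose q := (\prod_j den j)%N; exists q.
  by apply: prodn_gt0 => j; rewrite absz_gt0 denq_neq0.
exists (\row_j (numq (v 0 j) * (\prod_(i | i != j) den i)%N%:Z)).
apply/rowP => j; rewrite !mxE /= /q (bigD1 j)//= natrM intrM mulrAC; congr (_ * _).
have -> : (den j)%:R = (denq (v 0 j))%:~R :> R.
  by rewrite -[LHS]/((den j)%:Z%:~R) abszE gtr0_norm ?denq_gt0.
by rewrite /ratr mulrC divfK// intr_eq0 denq_neq0.
Qed.

Lemma integral_dvd (q g : nat) v : (q %| g)%N -> integral_point (q%:R *: v) ->
  integral_point (g%:R *: v).
Proof.
move=> /dvdnP[k ->] [z vz]; exists (k%:Z *: z); rewrite natrM -scalerA vz.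
by apply/rowP => j; rewrite !mxE /= intrM.
Qed.

Lemma rational_vertices P : rational_polytope P -> (0 < denominator P)%N /\
  exists2 s : seq 'rV[R]_d, P = conv s &
    forall v, v \in s -> integral_point ((denominator P)%:R *: v).
Proof.
move=> [V PV]; set s0 : seq 'rV[R]_d := [seq map_mx ratr v | v : 'rV[rat]_d <- V] in PV.
have [t [ts tv]] := conv_vertices s0.
(* A common denominator of the spanning points shows that the set defining [denominator P] is
   nonempty. *)
have [q q0 hq] : exists2 q : nat, (0 < q)%N &
    forall v, v \in s0 -> integral_point (q%:R *: v).
  rewrite /s0; elim: V {s0 PV t ts tv} => [|v V [q q0 IHV]]; first by exists 1%N.
  have [q' q'0 hq'] := rat_row_integral v; exists (q * q')%N; first by rewrite muln_gt0 q0.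
  move=> u; rewrite /= inE => /predU1P[->|/IHV].
    by apply: integral_dvd hq'; rewrite dvdn_mull.
  by apply: integral_dvd; rewrite dvdn_mulr.
have [] := @leastP [set q | (0 < q)%N /\
    forall v, vertex (dilate q P) v -> integral_point v] q.
  split=> // v [[x xP qx] [a ha]]; move: xP; rewrite PV => xP.
  have qR : (0 : R) < q%:R by rewrite ltr0n.
  case: (pselect (x \in s0)) => [|xs]; first by rewrite -qx; apply: hq.
  (* A vertex outside the spanning list would strictly exceed every listed point, hence itself by
     [conv_lt]. *)
  suff : dot x a < dot x a by rewrite ltxx.
  apply: (conv_lt _ xP) => u us; rewrite -(ltr_pM2l qR) -!dotZl qx; apply: ha.
    by exists u => //; rewrite PV; apply: mem_conv.
  by rewrite -qx => /(scalerI (lt0r_neq0 qR)) ux; apply: xs; rewrite -ux.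
rewrite -/(denominator P) => -[dP hP] _; split=> //; exists t; first by rewrite ts PV.
move=> v /tv; rewrite -PV => -[Pv [a ha]]; apply: hP; split; first by exists v.
exists a => _ [y Py <-] yv; rewrite -![(_ *m a) 0 0]/(dot _ a) !dotZl ltr_pM2l ?ltr0n//.
by apply: ha => // yv'; apply: yv; rewrite yv'.
Qed.

End Hulls.

(** * The cone over a polytope *)

Section Homogenization.
Local Open Scope classical_set_scope.
Variables (R : realType) (d g : nat).
Hypothesis g_gt0 : (0 < g)%N.
Implicit Types (v p : 'rV[R]_d) (s : seq 'rV[R]_d) (k : nat).

(** The point (v, 1) scaled to height [g], where it is integral once [g] clears the denominators of
    [v]. *)
Definition lift_row v : 'rV[R]_(d + 1) := row_mx (g%:R *: v) (const_mx g%:R).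

Definition gens s : 'M[R]_(size s, d + 1) := \matrix_(i < size s) lift_row s`_i.

Let gR : (0 : R) < g%:R. Proof. by rewrite ltr0n. Qed.

Lemma gens_ht s i : gens s i (rshift d 0) = g%:R.
Proof. by rewrite mxE row_mxEr mxE. Qed.

Lemma gens_int s : (forall v, v \in s -> integral_point (g%:R *: v)) ->
  forall i, integral_point (row i (gens s)).
Proof.
move=> sI i; have [z vz] := sI _ (mem_nth 0 (ltn_ord i)).
exists (row_mx z (const_mx g%:Z)); rewrite rowK /lift_row vz map_row_mx.
by congr row_mx; apply/rowP => j; rewrite !mxE.
Qed.

Lemma mul_gens s (l : 'rV[R]_(size s)) : l *m gens s =
  row_mx (g%:R *: \sum_i l 0 i *: s`_i) (const_mx (g%:R * \sum_i l 0 i)).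
Proof.
rewrite mulmx_sum_row; transitivity (\sum_i row_mx (l 0 i *: (g%:R *: s`_i))
    (const_mx (l 0 i * g%:R) : 'rV_1)).
  apply: eq_bigr => i _; rewrite rowK scale_row_mx; congr row_mx.
  by apply/rowP => j; rewrite !mxE.
have sum_row (I : Type) (r : seq I) (A : I -> 'rV[R]_d) (B : I -> 'rV[R]_1) :
    \sum_(i <- r) row_mx (A i) (B i) = row_mx (\sum_(i <- r) A i) (\sum_(i <- r) B i).
  elim: r => [|i r IHr]; first by rewrite !big_nil row_mx0.
  by rewrite !big_cons IHr add_row_mx.
rewrite sum_row scaler_sumr; congr row_mx.
  by apply: eq_bigr => i _; rewrite !scalerA mulrC.
apply/rowP => j; rewrite summxE mxE mulr_sumr.
by apply: eq_bigr => i _; rewrite mxE mulrC.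
Qed.

Lemma sum_below (V : nmodType) s k (E : nat -> V) : (k <= size s)%N ->
  \sum_(i < size s) (if (i < k)%N then E i else 0) = \sum_(0 <= i < size (take k s)) E i.
Proof.
move=> ks; rewrite size_takel// big_mkord (big_ord_widen _ (fun i => E i) ks).
by rewrite [RHS]big_mkcond.
Qed.

Lemma cone_gens s k y : (0 < k <= size s)%N ->
  cone (conv (take k s)) y <-> exists l,
    [/\ supported (@below (size s) k) l, forall i, 0 <= l 0 i & y = l *m gens s].
Proof.
move=> /andP[k0 ks]; split.
  move=> [t [p [t0 /convP[a [a0 a1 pE]] ->]]].
  (* Division by [g] compensates for the height of the generators. *)
  exists (\row_i (if (i < k)%N then t / g%:R * a i else 0)); split.
  - by move=> j; rewrite finset.in_set mxE => /negPf->.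
  - by move=> i; rewrite mxE; case: ifP => // _; rewrite mulr_ge0// divr_ge0// ltW.
  rewrite mul_gens scale_row_mx; congr row_mx.
    rewrite pE (eq_bigr (fun i : 'I_(size s) =>
      if (i < k)%N then (t / g%:R * a i) *: s`_i else 0)); last first.
      by move=> i _; rewrite mxE; case: ifP => _; rewrite ?scale0r.
    rewrite (sum_below (fun i => (t / g%:R * a i) *: s`_i))// !scaler_sumr.
    apply: eq_big_nat => i /andP[_]; rewrite size_takel// => ik.
    by rewrite nth_take// !scalerA; congr (_ *: _); field; rewrite gt_eqF.
  apply/rowP => j; rewrite !mxE mulr1.
  rewrite (eq_bigr (fun i : 'I_(size s) =>
    if (i < k)%N then t / g%:R * a i else 0)); last by move=> i _; rewrite mxE.
  rewrite (sum_below (fun i => t / g%:R * a i))// -mulr_sumr a1 mulr1.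
  by rewrite mulrC divfK// gt_eqF.
move=> [l [sl l0 ->]]; rewrite mul_gens.
have [T0|T0] := eqVneq (\sum_i l 0 i) 0.
  (* At the apex the scalar is 0, but a point of the polytope must still be given; [0 < k] supplies
     one. *)
  exists 0, s`_0; split=> //.
    apply: mem_conv; rewrite -(nth_take _ k0); apply: mem_nth.
    by rewrite size_takel.
  have lz i : l 0 i = 0.
    by move/psumr_eq0P: T0 => /(_ (fun i _ => l0 i)); apply.
  by rewrite T0 mulr0 scale0r big1 ?scaler0 ?row_mx0// => i _; rewrite lz scale0r.
set T := \sum_i l 0 i in T0 *.
have Tge0 : 0 <= T by apply: sumr_ge0.
pose a (i : nat) : R := if insub i is Some j then l 0 j / T else 0.
have sumE (V : lmodType R) (E : nat -> V) :
    \sum_(0 <= i < size (take k s)) a i *: E i = T^-1 *: \sum_i l 0 i *: E i.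
  rewrite -sum_below// scaler_sumr; apply: eq_bigr => i _.
  case: ifPn => ik; first by rewrite /a valK scalerA mulrC.
  by rewrite sl ?scale0r ?scaler0// finset.in_set.
exists (g%:R * T), (T^-1 *: \sum_i l 0 i *: s`_i); split.
- by rewrite mulr_ge0// ltW.
- apply/convP; exists a; split.
  + by move=> i; rewrite /a; case: insub => // j; rewrite divr_ge0.
  + have := sumE R^o (fun=> 1); rewrite /GRing.scale /= => E1.
    rewrite (eq_bigr (fun i => a i * 1)); last by move=> i _; rewrite mulr1.
    rewrite E1 (eq_bigr (fun i => l 0 i)); last by move=> i _; rewrite mulr1.
    by rewrite mulVf.
  + rewrite -sumE; apply: eq_big_nat => i /andP[_]; rewrite size_takel// => ik.
    by rewrite nth_take.
rewrite scale_row_mx scalerA mulfK//; congr row_mx.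
by apply/rowP => j; rewrite !mxE mulr1.
Qed.

Lemma ehr_cone_sum s k (w : {mpoly R[d + 1]}) (n : nat) : (0 < k <= size s)%N ->
  ehr (conv (take k s)) w n =
  cone_sum (gens s) g (fun y : 'rV[R]_(d + 1) => w.@[y 0]) k n%:Z.
Proof.
move=> ks; rewrite /ehr /cone_sum; apply: eq_fsbigl; apply/seteqP.
have ht (l : 'rV[R]_(size s)) : (l *m gens s) 0 (rshift d 0) = g%:R * \sum_i l 0 i.
  by apply: height => i; apply: gens_ht.
split=> x.
  move=> [/(cone_gens _ ks)[l [sl l0 xl]] xn]; exists l; split=> //.
  by rewrite -ht -xl mxE xn.
move=> [l [sl l0 ln xl]]; split; first by apply/(cone_gens _ ks); exists l.
by have := ht l; rewrite ln -xl mxE => /intr_inj.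
Qed.

Lemma direction_dim_conv p s : direction_dim (conv (p :: s)) =
  \dim <<[seq v - p | v <- p :: s]>>.
Proof.
set W := <<_>>%VS.
have hW x y : conv (p :: s) x -> conv (p :: s) y -> x - y \in W.
  have xW z : conv (p :: s) z -> z - p \in W.
    move=> /convP[a [a0 a1 ->]].
    rewrite -[p in _ - p]scale1r -a1 scaler_suml -sumrB big_nat.
    apply: memv_suml => i /andP[_ si]; rewrite -scalerBr memvZ// memv_span//.
    by apply: (map_f (fun v => v - p)); apply: mem_nth.
  by move=> /xW hx /xW hy; rewrite -(subrK p x) -addrA memvD// -opprB memvN.
pose dims := [set n | exists V : {vspace 'rV[R]_d},
  (forall x y, conv (p :: s) x -> conv (p :: s) y -> x - y \in V) /\ \dim V = n].
have [[V [hV dV]] mind] := @leastP dims (\dim W) (ex_intro _ W (conj hW erefl)).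
apply/eqP; rewrite eqn_leq mind /=; last by exists W.
rewrite /direction_dim -/dims -dV; apply: dimvS; apply/span_subvP => _ /mapP[v vs ->].
by apply: hV; apply: mem_conv => //; rewrite inE eqxx.
Qed.

(** The lifted points span the line through one of them plus a copy of the directions at height 0;
    the last coordinate shows that the sum is direct. *)
Lemma dim_lift p s :
  \dim <<[seq lift_row v | v <- p :: s]>> = (\dim <<[seq v - p | v <- p :: s]>>).+1.
Proof.
pose f : 'Hom('rV[R]_d, 'rV[R]_(d + 1)) := linfun (mulmxr (row_mx 1%:M 0)).
have fE v : f v = row_mx v 0 by rewrite lfunE /= mul_mx_row mulmx1 mulmx0.
set W := <<[seq v - p | v <- _]>>%VS.
have liftE v : lift_row v = lift_row p + g%:R *: f (v - p).
  rewrite fE scale_row_mx scaler0 add_row_mx addr0 scalerBr addrC subrK //.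
have -> : <<[seq lift_row v | v <- p :: s]>>%VS = (<[lift_row p]> + f @: W)%VS.
  apply/eqP; rewrite eqEsubv; apply/andP; split.
    apply/span_subvP => _ /mapP[v vs ->]; rewrite liftE; apply: memv_add.
      exact: memv_line.
    by rewrite memvZ// memv_img// memv_span// (map_f (fun v => v - p)).
  rewrite subv_add -memvE memv_span ?map_f ?inE ?eqxx//= limg_span.
  apply/span_subvP => _ /mapP[_ /mapP[v vs ->] ->].
  have -> : f (v - p) = g%:R^-1 *: (lift_row v - lift_row p).
    by rewrite (liftE v) addrAC subrr add0r scalerA mulVf ?scale1r// gt_eqF.
  by apply: memvZ; apply: memvB; apply: memv_span;
    apply: (@map_f _ _ lift_row (p :: s)) => //; rewrite inE eqxx.
rewrite dimv_disjoint_sum; last first.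
  apply/eqP; rewrite -subv0; apply/subvP => x; rewrite memv_cap memv0.
  move=> /andP[/vlineP[t ->] /memv_imgP[y _]]; rewrite fE.
  move=> /rowP/(_ (rshift d 0)); rewrite mxE !row_mxEr !mxE => /eqP.
  by rewrite mulf_eq0 (gt_eqF gR) orbF => /eqP->; rewrite scale0r.
rewrite dim_vline (_ : lift_row p != 0); last first.
  apply/eqP => /rowP/(_ (rshift d 0)); rewrite row_mxEr !mxE => /eqP.
  by rewrite gt_eqF.
rewrite limg_dim_eq// (_ : lker f = 0%VS) ?capv0//.
apply/eqP; rewrite -subv0; apply/subvP => x; rewrite memv_ker memv0 fE.
by rewrite -row_mx0 => /eqP/eq_row_mx[->].
Qed.

Lemma rk_gens s k : (0 < k <= size s)%N ->
  rk (gens s) (@below (size s) k) = (direction_dim (conv (take k s))).+1.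
Proof.
move=> /andP[k0 ks]; rewrite /rk.
have -> : <<[seq row i (gens s) | i in @below (size s) k]>>%VS =
    <<[seq lift_row v | v <- take k s]>>%VS.
  apply: eq_span => x; apply/fintype.imageP/mapP => [[i]|[v]].
    rewrite finset.in_set => ik ->; exists s`_i; last by rewrite rowK.
    by rewrite -(nth_take _ ik) mem_nth// size_takel.
  move=> /(nthP 0)[i]; rewrite size_takel// => ik <- ->; rewrite nth_take//.
  by exists (Ordinal (leq_trans ik ks)); rewrite ?finset.in_set// rowK.
case: (take k s) (size_takel ks) => [|p t] e; first by rewrite -e in k0.
by rewrite direction_dim_conv dim_lift.
Qed.

Lemma hstar_exp_gens s k m : (0 < k <= size s)%N ->
  hstar_exp (conv (take k s)) m = (rk (gens s) (@below (size s) k) + m)%N.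
Proof.
move=> ks; rewrite rk_gens// /hstar_exp /pdim; case: asboolP => [c0|_].
  case/andP: ks => k0 ks; have : conv (take k s) s`_0.
    by apply: mem_conv; rewrite -(nth_take _ k0); apply: mem_nth; rewrite size_takel.
  by rewrite c0.
by rewrite -!PoszD /= addn1 addSn.
Qed.

End Homogenization.

(** * Homogeneous weights as combinations of products of linear forms *)

Section Weights.
Local Open Scope classical_set_scope.
Variables (R : realType) (d : nat).

Lemma meval_linear n D (U : 'M[R]_(n, D)) (l : {mpoly R[D]}) (v : 'rV[R]_n) :
  l \is 1.-homog -> l.@[(v *m U) 0] = \sum_i v 0 i * l.@[(row i U) 0].
Proof.
move=> /dhomogP hl; rewrite mevalE.
under [RHS]eq_bigr do rewrite mevalE mulr_sumr.
rewrite exchange_big /=; apply: eq_big_seq => mon /hl /eqP/mdeg1P[j /eqP ->].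
have prodU (x : 'I_D -> R) : \prod_i x i ^+ U_(j)%MM i = x j.
  rewrite (bigD1 j)//= mnm1E eqxx expr1 big1 ?mulr1// => i ij.
  by rewrite mnm1E eq_sym (negPf ij) expr0.
rewrite prodU mxE mulr_sumr; apply: eq_bigr => i _.
by rewrite prodU mxE mulrCA.
Qed.

(** A homogeneous [w] equals its component of degree [m], and a product of linear forms survives in
    that component exactly when it has [m] factors. *)
Lemma weight_homog (Q : set 'rV[R]_d) (m : nat) (w : {mpoly R[d + 1]}) :
    weight_semiring Q w -> w \is m.-homog ->
  exists s : seq (R * m.-tuple {mpoly R[d + 1]}),
    (forall cp, cp \in s -> 0 < cp.1 /\
       forall j, nonneg_linear_form Q (tnth cp.2 j)) /\
    w = \sum_(cp <- s) cp.1 *: \prod_j tnth cp.2 j.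
Proof.
move=> [s [hs ws]] /pihomog_dE; rewrite {}ws linear_sum /= => <-.
elim: s hs => [|[c ls] s IHs] hs; first by exists [::]; split=> //; rewrite !big_nil.
have [|s' [hs' e']] := IHs; first by move=> cp cps; apply: hs; rewrite inE cps orbT.
have [c0 hl] := hs (c, ls) (mem_head _ _).
have homl : \prod_(l <- ls) l \is (size ls).-homog.
  elim: ls hl {hs c0} => [|l ls IHl] hl; first by rewrite big_nil dhomog1.
  rewrite big_cons -[size _]/(1 + size ls)%N; apply: dhomogM.
    by have [] := hl l (mem_head _ _).
  by apply: IHl => l' l'in; apply: hl; rewrite inE l'in orbT.
rewrite big_cons e' linearZ /=; case: (eqVneq (size ls) m) => [sz|szm]; last first.
  by exists s'; split=> //; rewrite (pihomog_ne0 szm homl) scaler0 add0r.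
subst m; exists ((c, in_tuple ls) :: s'); split.
  move=> cp; rewrite inE => /predU1P[->|/hs'//] /=; split=> // j.
  by apply: hl; rewrite /= (mem_tnth j (in_tuple ls)).
rewrite big_cons /= pihomog_dE//; congr (_ *: _ + _).
by rewrite -[in LHS](in_tupleE ls) big_tuple.
Qed.

End Weights.

(** * From numerators to h*-polynomials *)

Section PowerSeries.
Variable R : realType.
Implicit Types (p r : {poly R}) (a : nat -> R).

Definition pcoef p a (n : nat) : R := \sum_(i < n.+1) p`_i * a (n - i)%N.

Lemma pcoefE p a (N n : nat) : (n < N)%N -> pcoef p a n = (p * \poly_(i < N) a i)`_n.
Proof.
move=> nN; rewrite coefM; apply: eq_bigr => i _.
by rewrite coef_poly (leq_ltn_trans (leq_subr _ _) nN).
Qed.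

Lemma pcoefM p r a n : pcoef (p * r) a n = pcoef p (pcoef r a) n.
Proof.
rewrite (pcoefE _ _ (ltnSn n)) -mulrA coefM; apply: eq_bigr => i _.
by rewrite -pcoefE// ltnS leq_subr.
Qed.

Lemma eq_pcoef p a b n : (forall i, a i = b i) -> pcoef p a n = pcoef p b n.
Proof. by move=> ab; apply: eq_bigr => i _; rewrite ab. Qed.

Lemma pcoef0 p n : pcoef p (fun=> 0) n = 0.
Proof. by apply: big1 => i _; rewrite mulr0. Qed.

Lemma pcoef_sum (T : Type) (r : seq T) (b : T -> R) (a : T -> nat -> R) p n :
  pcoef p (fun n => \sum_(t <- r) b t * a t n) n = \sum_(t <- r) b t * pcoef p (a t) n.
Proof.
under [RHS]eq_bigr do rewrite /pcoef mulr_sumr.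
rewrite exchange_big /=; apply: eq_bigr => i _; rewrite mulr_sumr.
by apply: eq_bigr => t _; rewrite mulrCA.
Qed.

(** Vanishing at negative integers settles [n < g], where the shifted series has no term. *)
Lemma pcoef_nab (g e : nat) (a : int -> R) (n : nat) :
    (forall N : int, N < 0 -> a N = 0) ->
  pcoef ((1 - 'X^g) ^+ e) (fun n => a n%:Z) n = iter e (nab g) a n%:Z.
Proof.
move=> a0; have an0 e' N : N < 0 -> iter e' (nab g) a N = 0.
  move=> N0; elim: e' N N0 => [|e' IHe] N N0 /=; first exact: a0.
  rewrite /nab !IHe ?subrr//; apply: le_lt_trans N0.
  by rewrite lerBlDr lerDl.
elim: e n => [|e IHe] n.
  rewrite expr0 /pcoef big_ord_recl coef1 mul1r subn0 big1 ?addr0// => i _.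
  by rewrite coef1 mul0r.
rewrite exprS pcoefM (eq_pcoef _ _ IHe).
rewrite (pcoefE _ _ (ltnSn n)) mulrBl mul1r coefB coefXnM !coef_poly ltnSn /= /nab.
congr (_ - _); case: ltnP => ng; first by rewrite an0// subr_lt0 ltz_nat.
by rewrite ltnS leq_subr subzn.
Qed.

Lemma mul_geom_poly (q g : nat) : (q %| g)%N -> geom_poly R q g * (1 - 'X^q) = 1 - 'X^g.
Proof.
move=> qg; have -> : 'X^g = ('X^q) ^+ (g %/ q) :> {poly R}.
  by rewrite -exprM mulnC divnK.
rewrite -[RHS]opprB subrX1 -mulNr opprB mulrC; congr (_ * _).
by apply: eq_bigr => i _; rewrite -exprM mulnC.
Qed.

End PowerSeries.

Section HStar.
Local Open Scope classical_set_scope.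
Variables (R : realType) (d : nat).
Implicit Types (P Q : set 'rV[R]_d) (w : {mpoly R[d + 1]}) (s : seq 'rV[R]_d).

(** When [g] is the denominator of [P] these are the coefficients of h*; for a common multiple they
    are those of one side of the inequality. *)
Definition hcoef P w (m g n : nat) : R :=
  pcoef ((1 - 'X^g) ^+ hstar_exp P m) (ehr P w) n.

Lemma cone_sum_neg n D (U : 'M[R]_(n, D)) (g : nat) (f : 'rV[R]_D -> R) k (N : int) :
  N < 0 -> cone_sum U g f k N = 0.
Proof.
move=> N0; apply: fsbig1 => x [l [_ l0 lN _]]; exfalso; move: N0.
by rewrite -(ltr_int R) -lN ltNge mulr_ge0// sumr_ge0.
Qed.

Lemma ehr_sum s k g (T : Type) (r : seq T) (b : T -> R) (f : T -> {mpoly R[d + 1]}) n :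
    (0 < g)%N -> (0 < k <= size s)%N ->
  ehr (conv (take k s)) (\sum_(t <- r) b t *: f t) n =
  \sum_(t <- r) b t * ehr (conv (take k s)) (f t) n.
Proof.
move=> g0 ks; rewrite (ehr_cone_sum g0 _ _ ks).
under [RHS]eq_bigr do rewrite (ehr_cone_sum g0 _ _ ks).
have fin := finite_slice (gens g s) g0 (@below (size s) k) n%:Z.
rewrite /cone_sum fsbig_finite//=.
under [RHS]eq_bigr do rewrite fsbig_finite//= mulr_sumr.
rewrite [RHS]exchange_big /=; apply: eq_bigr => x _; rewrite raddf_sum /=.
by apply: eq_bigr => t _; rewrite mevalZ.
Qed.

Section Generators.
Variables (s : seq 'rV[R]_d) (g m : nat) (w : {mpoly R[d + 1]}).
Hypothesis g_gt0 : (0 < g)%N.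
Hypothesis s_int : forall v, v \in s -> integral_point (g%:R *: v).

Let num (ls : m.-tuple {mpoly R[d + 1]}) :=
  numerator (gens g s) g m (fun y : 'rV[R]_(d + 1) => (\prod_j tnth ls j).@[y 0]).

Lemma hcoef_numerator k n (S : seq (R * m.-tuple {mpoly R[d + 1]})) :
    (0 < k <= size s)%N -> w = \sum_(cp <- S) cp.1 *: \prod_j tnth cp.2 j ->
  hcoef (conv (take k s)) w m g n = \sum_(cp <- S) cp.1 * num cp.2 k n%:Z.
Proof.
move=> ks ->; rewrite /hcoef (eq_pcoef _ _ (fun i => ehr_sum _ _ _ i g_gt0 ks)) pcoef_sum.
apply: eq_bigr => cp _; congr (_ * _).
rewrite (eq_pcoef _ _ (fun i => ehr_cone_sum g_gt0 _ i ks)) pcoef_nab; last first.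
  by move=> N N0; apply: cone_sum_neg.
by rewrite (hstar_exp_gens g_gt0).
Qed.

(** The facts about numerators hold for each product of [m] forms and pass to positive combinations;
    the bound on the degree is the same for all products. *)
Lemma hcoef_facts : weight_semiring (conv s) w -> w \is m.-homog ->
  [/\ forall k1 k2 n, (0 < k1 <= k2)%N -> (k2 <= size s)%N ->
        hcoef (conv (take k1 s)) w m g n <= hcoef (conv (take k2 s)) w m g n,
      forall k n, (0 < k <= size s)%N -> 0 <= hcoef (conv (take k s)) w m g n &
      exists B, forall k n, (0 < k <= size s)%N -> (B < n)%N ->
        hcoef (conv (take k s)) w m g n = 0].
Proof.
move=> wQ wm; have [S [hS wS]] := weight_homog wQ wm.
pose c (ls : m.-tuple {mpoly R[d + 1]}) (j : 'I_m) (i : 'I_(size s)) :=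
  (tnth ls j).@[(row i (gens g s)) 0].
have U_int := gens_int s_int.
have U_ht (i : 'I_(size s)) : gens g s i (rshift d 0) = g%:R by apply: gens_ht.
have w_prod cp : cp \in S -> forall l : 'rV[R]_(size s),
    (\prod_j tnth cp.2 j).@[(l *m gens g s) 0] = \prod_j \sum_i l 0 i * c cp.2 j i.
  move=> /hS[_ hcp] l; rewrite rmorph_prod; apply: eq_bigr => j _.
  by rewrite /= meval_linear//; case: (hcp j).
(* The forms are nonnegative on the generators because these lie in the cone over [conv s]. *)
have c_ge0 cp : cp \in S -> forall j i, 0 <= c cp.2 j i.
  move=> /hS[_ hcp] j i; case: (hcp j) => _; apply.
  rewrite -[X in cone (conv X)](take_size s); apply/(cone_gens g_gt0).
    by rewrite leqnn andbT (leq_ltn_trans _ (ltn_ord i)).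
  exists (delta_mx 0 i); split; last by rewrite rowE.
    by move=> j' ; rewrite finset.in_set ltn_ord.
  by move=> i'; rewrite mxE; case: andP.
split.
- move=> k1 k2 n /andP[k10 k12] k2s.
  rewrite !(hcoef_numerator _ _ wS) ?k10 ?(leq_trans k12)//; last first.
    by rewrite k2s andbT (leq_trans k10).
  rewrite big_seq [leRHS]big_seq; apply: ler_sum => cp cpS; apply: ler_wpM2l.
    by case: (hS _ cpS) => /ltW.
  exact: (numerator_mono g_gt0 U_int U_ht (w_prod _ cpS) (c_ge0 _ cpS)).
- move=> k n ks; rewrite (hcoef_numerator _ ks wS) big_seq; apply: sumr_ge0 => cp cpS.
  apply: mulr_ge0; first by case: (hS _ cpS) => /ltW.
  exact: (numerator_ge0 g_gt0 U_int U_ht (w_prod _ cpS) (c_ge0 _ cpS)).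
exists (g * (size s * m.+1))%N => k n ks nB.
rewrite (hcoef_numerator _ ks wS) big_seq big1// => cp cpS.
by rewrite /num (numerator_out g_gt0 U_int U_ht (w_prod _ cpS)) ?mulr0// ltz_nat.
Qed.

End Generators.

Lemma ehr_set0 w n : ehr set0 w n = 0.
Proof. by apply: fsbig1 => x [[c [p [_ []]]]]. Qed.

Lemma conv_nil : conv [::] = set0 :> set 'rV[R]_d.
Proof.
apply/seteqP; split=> // x /convP[a [_ + _]]; rewrite big_geq// => /eqP.
by rewrite eq_sym oner_eq0.
Qed.

Lemma weight_semiringS P Q : P `<=` Q -> weight_semiring Q `<=` weight_semiring P.
Proof.
move=> sPQ w [s [hs ->]]; exists s; split=> // cp /hs[c0 hl]; split=> // l /hl[l1 l0].
split=> // x [c [p [c0' Pp ->]]]; apply: l0; exists c, p; split=> //; exact: sPQ.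
Qed.

(** By [hcoef_facts] with generators at height [denominator P], the coefficients are eventually
    zero; so a polynomial satisfying [is_hstar] exists and [hstar] does not take its junk value. *)
Lemma hstarP P w m : rational_polytope P -> weight_semiring P w -> w \is m.-homog ->
  forall n, (hstar P w m)`_n = hcoef P w m (denominator P) n.
Proof.
move=> /rational_vertices[dP [s Ps s_int]] wP wm.
suff [B hB] : exists B, forall n, (B < n)%N -> hcoef P w m (denominator P) n = 0.
  have ex : [set h | is_hstar P w m h] (\poly_(i < B.+1) hcoef P w m (denominator P) i).
    by move=> n; rewrite coef_poly; case: ltnP => // /hB.
  exact: (xgetPex 0 (ex_intro _ _ ex)).
case: s => [|p s] in Ps s_int *.
  exists 0%N => n _; rewrite Ps conv_nil /hcoef (@eq_pcoef _ _ _ (fun=> 0)) ?pcoef0//.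
  exact: ehr_set0.
rewrite Ps in wP; have [_ _ [B hB]] := hcoef_facts dP s_int wP wm.
exists B => n nB; have := hB (size (p :: s)) n; rewrite take_size -Ps; apply=> //.
by rewrite leqnn.
Qed.

(** With spanning points of [P] listed before those of [Q], the hull of a prefix is [P] and, by
    inclusion, the hull of the whole list is [Q]. *)
Lemma hcoef_mono P Q w (m g : nat) n :
    rational_polytope P -> rational_polytope Q -> P `<=` Q ->
    weight_semiring Q w -> w \is m.-homog -> (0 < g)%N ->
    (denominator P %| g)%N -> (denominator Q %| g)%N ->
  hcoef P w m g n <= hcoef Q w m g n.
Proof.
move=> /rational_vertices[_ [sP PE sP_int]] /rational_vertices[_ [sQ QE sQ_int]].
move=> sPQ wQ wm g0 gP gQ.
have s_int v : v \in sP ++ sQ -> integral_point (g%:R *: v).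
  by rewrite mem_cat => /orP[/sP_int|/sQ_int]; apply: integral_dvd.
have convQ : conv (sP ++ sQ) = Q.
  rewrite QE; apply/seteqP; split; apply: conv_sub => u.
    rewrite mem_cat => /orP[us|]; last exact: mem_conv.
    by rewrite -QE; apply: sPQ; rewrite PE; apply: mem_conv.
  by move=> us; apply: mem_conv; rewrite mem_cat us orbT.
have wC : weight_semiring (conv (sP ++ sQ)) w by rewrite convQ.
have [mono pos _] := hcoef_facts g0 s_int wC wm.
have P0 : P = set0 -> hcoef P w m g n = 0.
  by move=> ->; rewrite /hcoef (@eq_pcoef _ _ _ (fun=> 0)) ?pcoef0//; apply: ehr_set0.
(* An empty prefix is not covered by [mono]; the left side is then zero, and nonnegativity of the
   right side suffices. *)
have [sP0|sPn0] := eqVneq sP [::].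
  have PE0 : P = set0 by rewrite PE sP0 conv_nil.
  rewrite P0//; have [sQ0|sQn0] := eqVneq sQ [::].
    by rewrite QE sQ0 conv_nil -PE0 P0.
  have := pos (size (sP ++ sQ)) n; rewrite take_size convQ; apply.
  by rewrite leqnn andbT size_cat addn_gt0 orbC; case: (sQ) sQn0.
have := mono (size sP) (size (sP ++ sQ)) n.
rewrite take_size_cat// take_size convQ -PE; apply=> //.
by rewrite size_cat leq_addr andbT; case: (sP) sPn0.
Qed.

Lemma mul_geom_hstar P w (m g : nat) n : rational_polytope P ->
    weight_semiring P w -> w \is m.-homog -> (denominator P %| g)%N ->
  (geom_poly R (denominator P) g ^+ hstar_exp P m * hstar P w m)`_n = hcoef P w m g n.
Proof.
move=> P_rat wP wm dg; rewrite /hcoef -(mul_geom_poly _ dg) exprMn pcoefM coefM.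
by apply: eq_bigr => i _; rewrite hstarP.
Qed.

End HStar.

Local Open Scope classical_set_scope.

Theorem theorem2p8 (R : realType) (d : nat) (P Q : set 'rV[R]_d)
    (P_rat : rational_polytope P) (Q_rat : rational_polytope Q)
    (sPQ : P `<=` Q) (m : nat) (w : {mpoly R[d + 1]})
    (w_RQ : weight_semiring Q w) (w_homog : w \is m.-homog) :
  (forall g : nat, (0 < g)%N ->
     (denominator P %| g)%N -> (denominator Q %| g)%N ->
     coef_le (geom_poly R (denominator P) g ^+ hstar_exp P m * hstar P w m)
             (geom_poly R (denominator Q) g ^+ hstar_exp Q m * hstar Q w m)) /\
  (denominator P = denominator Q -> coef_le (hstar P w m) (hstar Q w m)).
Proof.
have w_RP := weight_semiringS sPQ w_RQ; split.
  by move=> g g0 gP gQ n; rewrite !mul_geom_hstar//; apply: hcoef_mono.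
(* The common denominator itself serves as [g]. *)
move=> dPQ n; rewrite !hstarP// dPQ; have [d0 _] := rational_vertices Q_rat.
by apply: hcoef_mono; rewrite ?dPQ.
Qed.
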